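(* Let $K$ be a countable algebraically closed field, let $k\geq0$ be an integer, let $Q$ be the cyclic quiver with vertices $0,1,\dots,k$ and arrows $a_i:i\to i+1$ for $i<k$ and $a_k:k\to0$, and let $M_{\omega_1}$ be the $KQ$-module defined in the context. Then $\mathsf{UP}$ implies $\mathrm{Ext}^1_{KQ}(M_{\omega_1},KQ)=0$. In particular, under $\mathsf{UP}$ it is not true that every $KQ$-module $M$ with $\mathrm{Ext}^n_{KQ}(M,KQ)=0$ for all $n\ge1$ is projective.
   Context: Paths in a quiver are composable sequences of arrows written left to right, with trivial paths $e_v$; the path algebra $KQ$ has basis all paths, product = concatenation when the target of the first equals the source of the second, else $0$. Modules are right modules; projective means every epimorphism onto it splits. $\omega_1$ is the first uncountable ordinal, $\mathrm{Lim}$ the class of nonzero limit ordinals. Fix a ladder system: for each $\alpha\in\omega_1\cap\mathrm{Lim}$ a set $C_\alpha=\{\zeta^\alpha_n:n\in\omega\}$, strictly increasingly enumerated and cofinal in $\alpha$, such that each $\zeta^\alpha_n$ equals $\delta+n+1$ for some $\delta\in\alpha\cap(\{0\}\cup\mathrm{Lim})$. For $\xi<\omega_1$ let $F^\xi=KQ$ if $\xi\notin\mathrm{Lim}$ and $F^\xi=\bigoplus_{n\in\omega}KQ$ if $\xi\in\mathrm{Lim}$; let $F=\bigoplus_{\xi<\omega_1}F^\xi$ (finite-support functions, coordinatewise operations). For $\gamma\in\omega_1\setminus\mathrm{Lim}$, $e^\gamma_0\in F$ has support $\{\gamma\}$ and value $e_0$ there; for $\alpha\in\mathrm{Lim}$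 and $n\in\omega$, $e^{\alpha,n}_0\in F$ has support $\{\alpha\}$ and value at $\alpha$ the element of $\bigoplus_{m}KQ$ with support $\{n\}$ and value $e_0$. Let $G_\alpha$ be the $KQ$-submodule of $F$ generated by $\{e^{\zeta^\alpha_n}_0-e^{\alpha,n}_0+e^{\alpha,n+1}_0a_0a_1\cdots a_k:n\in\omega\}$, let $I=\sum_{\alpha\in\omega_1\cap\mathrm{Lim}}G_\alpha$, and let $M_{\omega_1}$ be the $KQ$-submodule of $F/I$ generated by $\{e^\gamma_0+I:\gamma\in\omega_1\setminus\mathrm{Lim}\}\cup\{e^{\alpha,n}_0+I:\alpha\in\omega_1\cap\mathrm{Lim},n\in\omega\}$. $\mathsf{UP}$: for any sequence $\langle X_\beta:\beta<\omega_1\rangle$ of countable sets and any ladder system $\langle C_\alpha\rangle$ (each $C_\alpha=\{\zeta^\alpha_n\}$ cofinal in $\alpha$ of order type $\omega$) with functions $d_\alpha$ on $C_\alpha$ satisfying $d_\alpha(\zeta^\alpha_n)\in X_{\zeta^\alpha_n}$, there is a function $f$ on $\omega_1$ such that for each $\alpha$, $f(\zeta^\alpha_n)=d_\alpha(\zeta^\alpha_n)$ for all but finitely many $n$. *)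

(* Defs.v *)
From mathcomp Require Import all_boot all_algebra.
From Stdlib Require Import ClassicalDescription.

Set Implicit Arguments.
Unset Strict Implicit.
Unset Printing Implicit Defensive.

Import GRing.Theory.
Local Open Scope ring_scope.

(* The path algebra KQ of the cyclic quiver with vertices 0..k and arrows   *)
(* a_i : i -> i+1 (i<k), a_k : k -> 0.  A path is determined by its source  *)
(* v and its length l (the trivial path e_v has length 0).  An element of   *)
(* KQ (a finite K-linear combination of paths) is encoded as the finite     *)
(* function v |-> sum_l c_{v,l} X^l, i.e. c_{v,l} is the coefficient of the *)
(* path starting at v of length l.                                          *)
Section PathAlgebra.
Variables (K : fieldType) (k : nat).

Definition KQ := {ffun 'I_k.+1 -> {poly K}}.

Definition ptarget (v : 'I_k.+1) (l : nat) : 'I_k.+1 := inord ((v + l) %% k.+1).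

(* product = concatenation of composable paths, 0 otherwise, extended bilinearly *)
Definition kq_mul (f g : KQ) : KQ :=
  [ffun v => \sum_(l < size (f v)) (f v)`_l *: ('X^l * g (ptarget v l))].

(* 1 = sum of the trivial paths e_v *)
Definition kq_one : KQ := [ffun _ => 1].

Definition kq_e0 : KQ := [ffun v => if v == ord0 then 1 else 0].

(* the path a_0 a_1 ... a_k (from 0 to 0, length k+1) *)
Definition kq_cycle : KQ := [ffun v => if v == ord0 then 'X^(k.+1) else 0].

(* Right KQ-modules.  A module is given by a carrier type, a membership     *)
(* predicate (the underlying set of the module, a subset of the carrier),   *)
(* and the operations; [is_rmod] states the right-module axioms.            *)
Unset Implicit Arguments.
Record rmod := RMod {
  car : Type;
  mem : car -> Prop;
  mzero : car;
  madd : car -> car -> car;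
  mopp : car -> car;
  mscal : K -> car -> car;
  mact : car -> KQ -> car }.
Set Implicit Arguments.

Definition is_rmod (M : rmod) : Prop :=
  mem M (mzero M) /\
  (forall x y, mem M x -> mem M y -> mem M (madd M x y)) /\
  (forall x, mem M x -> mem M (mopp M x)) /\
  (forall c x, mem M x -> mem M (mscal M c x)) /\
  (forall x r, mem M x -> mem M (mact M x r)) /\
  (forall x y z, mem M x -> mem M y -> mem M z ->
      madd M x (madd M y z) = madd M (madd M x y) z) /\
  (forall x y, mem M x -> mem M y -> madd M x y = madd M y x) /\
  (forall x, mem M x -> madd M (mzero M) x = x) /\
  (forall x, mem M x -> madd M (mopp M x) x = mzero M) /\
  (forall c x y, mem M x -> mem M y ->
      mscal M c (madd M x y) = madd M (mscal M c x) (mscal M c y)) /\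
  (forall c d x, mem M x -> mscal M (c + d) x = madd M (mscal M c x) (mscal M d x)) /\
  (forall c d x, mem M x -> mscal M (c * d) x = mscal M c (mscal M d x)) /\
  (forall x, mem M x -> mscal M 1 x = x) /\
  (forall x y r, mem M x -> mem M y ->
      mact M (madd M x y) r = madd M (mact M x r) (mact M y r)) /\
  (forall x r s, mem M x -> mact M x (r + s) = madd M (mact M x r) (mact M x s)) /\
  (forall x r s, mem M x -> mact M x (kq_mul r s) = mact M (mact M x r) s) /\
  (forall x, mem M x -> mact M x kq_one = x) /\
  (forall c x r, mem M x -> mact M (mscal M c x) r = mscal M c (mact M x r)) /\
  (forall c x r, mem M x -> mact M x (c *: r) = mscal M c (mact M x r)).

Definition hom (M N : rmod) (f : car M -> car N) : Prop :=
  [/\ (forall x, mem M x -> mem N (f x)),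
      (forall x y, mem M x -> mem M y -> f (madd M x y) = madd N (f x) (f y)) &
      (forall x r, mem M x -> f (mact M x r) = mact N (f x) r)].

Definition projective (P : rmod) : Prop :=
  forall (E : rmod) (p : car E -> car P), is_rmod E -> hom p ->
    (forall y, mem P y -> exists x, mem E x /\ p x = y) ->
    exists s : car P -> car E, hom s /\ forall y, mem P y -> p (s y) = y.

Definition proj_resolution (M : rmod) (P : nat -> rmod)
  (d : forall n, car (P n.+1) -> car (P n)) (eps : car (P 0) -> car M) : Prop :=
  (forall n, is_rmod (P n) /\ projective (P n)) /\
  hom eps /\ (forall n, hom (d n)) /\
  (forall y, mem M y -> exists x, mem (P 0) x /\ eps x = y) /\
  (forall x, mem (P 0) x ->
      (eps x = mzero M <-> exists y, mem (P 1) y /\ d 0 y = x)) /\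
  (forall n x, mem (P n.+1) x ->
      (d n x = mzero (P n) <-> exists y, mem (P n.+2) y /\ d n.+1 y = x)).

(* Ext^(m+1)(M, N) = 0 : H^(m+1) of Hom(P_., N) vanishes (for projective
   resolutions P of M) *)
Definition Ext_vanish (m : nat) (M N : rmod) : Prop :=
  forall P d eps, @proj_resolution M P d eps ->
  forall f : car (P m.+1) -> car N, hom f ->
    (forall y, mem (P m.+2) y -> f (d m.+1 y) = mzero N) ->
    exists g : car (P m) -> car N, hom g /\
      forall x, mem (P m.+1) x -> f x = g (d m x).

Definition KQmod : rmod :=
  @RMod KQ (fun _ => True) 0 +%R (fun x => - x) (fun c x => c *: x) kq_mul.

Definition is_submod (M : rmod) (S : car M -> Prop) : Prop :=
  (forall x, S x -> mem M x) /\ S (mzero M) /\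
  (forall x y, S x -> S y -> S (madd M x y)) /\
  (forall x, S x -> S (mopp M x)) /\
  (forall c x, S x -> S (mscal M c x)) /\
  (forall x r, S x -> S (mact M x r)).

Definition span (M : rmod) (gens : car M -> Prop) : car M -> Prop :=
  fun x => mem M x /\
    forall S, @is_submod M S -> (forall g, gens g -> S g) -> S x.

Definition restrict (M : rmod) (S : car M -> Prop) : rmod :=
  @RMod (car M) S (mzero M) (madd M) (mopp M) (mscal M) (mact M).

Definition cls (M : rmod) (S : car M -> Prop) (x : car M) : car M -> Prop :=
  fun y => mem M y /\ S (madd M y (mopp M x)).

Definition quotient (M : rmod) (S : car M -> Prop) : rmod :=
  @RMod (car M -> Prop)
    (fun C => exists x, mem M x /\ C = cls S x)
    (cls S (mzero M))
    (fun C D y => mem M y /\ exists a b, C a /\ D b /\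
                     S (madd M y (mopp M (madd M a b))))
    (fun C y => mem M y /\ exists a, C a /\ S (madd M y a))
    (fun c C y => mem M y /\ exists a, C a /\ S (madd M y (mopp M (mscal M c a))))
    (fun C r y => mem M y /\ exists a, C a /\ S (madd M y (mopp M (mact M a r)))).

End PathAlgebra.

Arguments car {K k} r.
Arguments mem {K k} r _.
Arguments mzero {K k} r.
Arguments madd {K k} r _ _.
Arguments mopp {K k} r _.
Arguments mscal {K k} r _ _.
Arguments mact {K k} r _ _.

Section Omega1.
Variables (O : Type) (lt : O -> O -> Prop).

Definition is_omega1 : Prop :=
  (forall x, ~ lt x x) /\
  (forall x y z, lt x y -> lt y z -> lt x z) /\
  (forall x y, lt x y \/ x = y \/ lt y x) /\
  well_founded lt /\
  ~ (exists f : O -> nat, forall x y, f x = f y -> x = y) /\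
  (forall a, exists f : O -> nat,
      forall x y, lt x a -> lt y a -> f x = f y -> x = y).

Definition is_zero (x : O) : Prop := forall y, ~ lt y x.
Definition succ_of (x y : O) : Prop := lt x y /\ forall z, ~ (lt x z /\ lt z y).
Definition is_limit (a : O) : Prop := ~ is_zero a /\ forall x, ~ succ_of x a.

Fixpoint nth_succ (d : O) (m : nat) (z : O) : Prop :=
  match m with
  | 0 => z = d
  | m'.+1 => exists y, nth_succ d m' y /\ succ_of y z
  end.

Definition is_ladder (C : O -> nat -> O) : Prop :=
  forall a, is_limit a ->
    [/\ (forall n, lt (C a n) (C a n.+1)),
        (forall n, lt (C a n) a) &
        (forall b, lt b a -> exists n, lt b (C a n))].

Definition good_ladder (C : O -> nat -> O) : Prop :=
  is_ladder C /\
  forall a n, is_limit a ->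
    exists d, lt d a /\ (is_zero d \/ is_limit d) /\ nth_succ d n.+1 (C a n).

Definition countable_set (T : Type) (X : T -> Prop) : Prop :=
  exists f : T -> nat, forall x y, X x -> X y -> f x = f y -> x = y.

Definition UP : Prop :=
  forall (T : Type) (X : O -> T -> Prop), (forall b, countable_set (X b)) ->
  forall C : O -> nat -> O, is_ladder C ->
  forall dd : O -> nat -> T,
    (forall a n, is_limit a -> X (C a n) (dd a n)) ->
    exists f : O -> T, forall a, is_limit a ->
      exists N, forall n, (N <= n)%N -> f (C a n) = dd a n.

End Omega1.

Section Momega1.
Variables (K : fieldType) (k : nat) (O : Type) (lt : O -> O -> Prop)
          (C : O -> nat -> O).

(* ambient: all families (xi, n) |-> KQ; F^xi sits at coordinates (xi, n),
   with only n = 0 used when xi is not a limit *)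
Definition Amb := O -> nat -> KQ K k.

Definition F_mem (x : Amb) : Prop :=
  (exists s : seq (O * nat), forall xi n, x xi n <> 0 -> List.In (xi, n) s) /\
  (forall xi n, ~ is_limit lt xi -> n <> 0%N -> x xi n = 0).

Definition Fmod : rmod K k :=
  @RMod K k Amb F_mem (fun _ _ => 0) (fun x y xi n => x xi n + y xi n)
    (fun x xi n => - x xi n) (fun c x xi n => c *: x xi n)
    (fun x r xi n => kq_mul (x xi n) r).

Definition unitv (g : O) (m : nat) (r : KQ K k) : Amb :=
  fun xi n => if excluded_middle_informative (xi = g /\ n = m) then r else 0.

Definition e_succ (g : O) : Amb := unitv g 0 (kq_e0 K k).
Definition e_lim (a : O) (n : nat) : Amb := unitv a n (kq_e0 K k).

Definition Ggen (a : O) (n : nat) : Amb :=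
  madd Fmod (madd Fmod (e_succ (C a n)) (mopp Fmod (e_lim a n)))
            (mact Fmod (e_lim a n.+1) (kq_cycle K k)).

Definition G_alpha (a : O) : Amb -> Prop :=
  @span K k Fmod (fun x => exists n, x = Ggen a n).

Definition I_sub : Amb -> Prop :=
  @span K k Fmod (fun x => exists a, is_limit lt a /\ G_alpha a x).

Definition FmodI : rmod K k := @quotient K k Fmod I_sub.

Definition M_gens : car FmodI -> Prop :=
  fun D => exists x,
    ((exists g, ~ is_limit lt g /\ x = e_succ g) \/
     (exists a n, is_limit lt a /\ x = e_lim a n)) /\
    D = @cls K k Fmod I_sub x.

Definition M_omega1 : rmod K k := @restrict K k FmodI (@span K k FmodI M_gens).

End Momega1.

(* Main.v *)
From Pilot Require Import Defs.
From HB Require Import structures.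
From mathcomp Require Import all_boot all_algebra.
From mathcomp Require Import zify boolp.
From Stdlib Require Import ClassicalDescription.
Import Pilot.Defs.

(* Write M = F'/I with F' the span of the e_0's.  The generators of I are      *)
(* linearly independent over e_0 KQ (their coefficients are recovered by the   *)
(* recursion [psi]), so F' and I give a projective resolution of length one    *)
(* and Ext^n(M, -) = 0 for n >= 2.  For n = 1 one has to extend a              *)
(* homomorphism phi : I -> KQ to F', that is, to find values h with            *)
(*   h(zeta_n) - h(alpha, n) + h(alpha, n+1) a_0...a_k = phi(generator n).     *)
(* UP provides h(zeta_n) = phi(generator n) for almost all n; put              *)
(* h(alpha, n) = 0 there and solve for the finitely many remaining h(alpha, n) *)
(* downwards.  If M were projective, there would be an endomorphism theta of   *)
(* F' with kernel I and theta x - x in I.  Choose a limit alpha such that      *)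
(* theta maps the part of F' below alpha to itself; then the coordinates at    *)
(* alpha of theta(e^{alpha,0}) are infinitely divisible by the cycle, hence    *)
(* zero, and e^{alpha,0} - theta(e^{alpha,0}) would be an element of I with    *)
(* infinitely many nonzero coefficients.                                       *)

Set Implicit Arguments.
Unset Strict Implicit.
Unset Printing Implicit Defensive.

Import GRing.Theory.
Local Open Scope ring_scope.

(** * The path algebra *)

(** The outline above rests on the following lemmas. That I is free over its generators is [psi_gen]
    with [hom_psi]: composing [psi] with a map from [free_map] prescribes a homomorphism on I at its
    generators. Since KQ is countable, UP can colour the ladders with values in KQ, and
    [ladder_recursion] repairs the finitely many exceptions on each ladder; this gives [UP_extend].

    [Ext_vanish] speaks of every projective resolution P, so [resolution_comparison] relates P to
    the short resolution given by I inside F' ([Fbase]): maps in both directions and a homotopy. In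
    degree one, [cocycle0_coboundary] pulls a cocycle back to I, extends it to F and transports the
    extension to P. In higher degrees the same data split [d] over its image
    ([section_on_boundary]), and a split cocycle is a coboundary ([cocycleS_coboundary]).

    In [M_not_projective] the limit alpha comes from [omega1_closed_limit], and
    [kq_cycle_divisible_eq0] kills the infinitely divisible coordinates. The contradiction is
    between [psi_I], by which [psi] has finite support on I, and [psi_unit_notin_F], by which it has
    infinite support on an element whose row at alpha is e_0, 0, 0, and so on. *)

Section PathAlgebraTheory.
Variables (K : fieldType) (k : nat).
Local Notation KQ := (KQ K k).
Implicit Types (f g h : KQ) (p q : {poly K}) (v : 'I_k.+1).

Lemma val_ptarget v l : ptarget v l = ((v + l) %% k.+1)%N :> nat.
Proof. by rewrite /ptarget inordK // ltn_mod. Qed.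

Lemma ptarget0 v : ptarget v 0 = v.
Proof. by apply: ord_inj; rewrite val_ptarget addn0 modn_small. Qed.

Lemma ptargetD v l m : ptarget (ptarget v l) m = ptarget v (l + m).
Proof. by apply: ord_inj; rewrite !val_ptarget modnDml addnA. Qed.

Lemma ptarget_cycle v : ptarget v k.+1 = v.
Proof. by apply: ord_inj; rewrite val_ptarget modnDr modn_small. Qed.

(* [p] is read as a combination of paths that start at [v]. *)
Definition pact g v p : {poly K} :=
  \sum_(l < size p) p`_l *: ('X^l * g (ptarget v l)).

Lemma kq_mulE f g v : kq_mul f g v = pact g v (f v).
Proof. by rewrite ffunE. Qed.

Lemma pactE n g v p : (size p <= n)%N ->
  pact g v p = \sum_(l < n) p`_l *: ('X^l * g (ptarget v l)).
Proof.
move=> le_pn; rewrite /pact (big_ord_widen n (fun l => p`_l *: ('X^l * g (ptarget v l)))) //.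
rewrite big_mkcond; apply: eq_bigr => l _; case: ltnP => // le_pl.
by rewrite nth_default // scale0r.
Qed.

Lemma pactD g v p q : pact g v (p + q) = pact g v p + pact g v q.
Proof.
set n := maxn (size p) (size q).
rewrite (@pactE n _ _ p) ?leq_maxl // (@pactE n _ _ q) ?leq_maxr //.
rewrite (@pactE n) ?size_polyD // -big_split.
by apply: eq_bigr => l _; rewrite coefD scalerDl.
Qed.

Lemma pact0 g v : pact g v 0 = 0.
Proof. by rewrite /pact size_poly0 big_ord0. Qed.

Lemma pactZ g v c p : pact g v (c *: p) = c *: pact g v p.
Proof.
rewrite (@pactE (size p)) ?size_scale_leq // /pact scaler_sumr.
by apply: eq_bigr => l _; rewrite coefZ scalerA.
Qed.

(** Prefixing a path of length m moves the starting vertex to its target. This is the case of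
    monomials, to which associativity reduces by linearity. *)
Lemma pactXnM g v m p : pact g v ('X^m * p) = 'X^m * pact g (ptarget v m) p.
Proof.
rewrite (@pactE (m + size p)); last first.
  by apply: leq_trans (size_polyMleq _ _) _; rewrite size_polyXn.
rewrite big_split_ord /= big1 ?add0r; last first.
  by move=> i _; rewrite coefXnM ltn_ord scale0r.
rewrite /pact mulr_sumr; apply: eq_bigr => i _.
by rewrite coefXnM ltnNge leq_addr addKn ptargetD exprD -scalerAr mulrA.
Qed.

Lemma pactDr f g v p : pact (f + g) v p = pact f v p + pact g v p.
Proof.
by rewrite /pact -big_split; apply: eq_bigr => l _; rewrite ffunE mulrDr scalerDr.
Qed.

Lemma pactZr c g v p : pact (c *: g) v p = c *: pact g v p.
Proof.
rewrite /pact scaler_sumr; apply: eq_bigr => l _.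
by rewrite ffunE -scalerAr !scalerA mulrC.
Qed.

Lemma pact_mul g h v p : pact (kq_mul g h) v p = pact h v (pact g v p).
Proof.
rewrite [in RHS]/(pact g v p) (big_morph _ (pactD h v) (pact0 h v)) /pact.
by apply: eq_bigr => l _; rewrite -/(pact h v _) pactZ pactXnM kq_mulE.
Qed.

Lemma kq_mulA f g h : kq_mul f (kq_mul g h) = kq_mul (kq_mul f g) h.
Proof. by apply/ffunP => v; rewrite !kq_mulE pact_mul. Qed.

Lemma kq_mulDl f g h : kq_mul (f + g) h = kq_mul f h + kq_mul g h.
Proof. by apply/ffunP => v; rewrite [RHS]ffunE !kq_mulE [X in pact _ _ X]ffunE pactD. Qed.

Lemma kq_mulDr f g h : kq_mul f (g + h) = kq_mul f g + kq_mul f h.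
Proof. by apply/ffunP => v; rewrite [RHS]ffunE !kq_mulE pactDr. Qed.

Lemma kq_mulZl c f g : kq_mul (c *: f) g = c *: kq_mul f g.
Proof. by apply/ffunP => v; rewrite [RHS]ffunE !kq_mulE [X in pact _ _ X]ffunE pactZ. Qed.

Lemma kq_mulZr c f g : kq_mul f (c *: g) = c *: kq_mul f g.
Proof. by apply/ffunP => v; rewrite [RHS]ffunE !kq_mulE pactZr. Qed.

Lemma kq_mul1 f : kq_mul f (kq_one K k) = f.
Proof.
apply/ffunP => v; rewrite kq_mulE /pact -[RHS]coefK poly_def.
by apply: eq_bigr => l _; rewrite ffunE mulr1.
Qed.

Lemma kq_mul0 f : kq_mul f 0 = 0.
Proof. by have := kq_mulZr 0 f 0; rewrite !scale0r. Qed.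

Lemma kq_0mul f : kq_mul 0 f = 0.
Proof. by have := kq_mulZl 0 0 f; rewrite !scale0r. Qed.

Lemma kq_Nmul f g : kq_mul (- f) g = - kq_mul f g.
Proof. by rewrite -scaleN1r kq_mulZl scaleN1r. Qed.

Lemma pactXn g v m : pact g v 'X^m = 'X^m * g (ptarget v m).
Proof.
rewrite -['X^m]mulr1 pactXnM mulr1 /pact size_poly1 big_ord1 coef1 scale1r.
by rewrite mul1r ptarget0.
Qed.

Lemma pact1 g v : pact g v 1 = g v.
Proof. by rewrite -(expr0 'X) pactXn expr0 mul1r ptarget0. Qed.

Lemma kq_e0_e0 : kq_mul (kq_e0 K k) (kq_e0 K k) = kq_e0 K k.
Proof.
by apply/ffunP => v; rewrite kq_mulE [X in pact _ _ X]ffunE [RHS]ffunE;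
  case: eqVneq => [->|_]; rewrite ?pact0 // pact1 ffunE eqxx.
Qed.

Lemma kq_e0_cycle : kq_mul (kq_e0 K k) (kq_cycle K k) = kq_cycle K k.
Proof.
by apply/ffunP => v; rewrite kq_mulE [X in pact _ _ X]ffunE [RHS]ffunE;
  case: eqVneq => [->|_]; rewrite ?pact0 // pact1 ffunE eqxx.
Qed.

Lemma kq_cycle_e0 : kq_mul (kq_cycle K k) (kq_e0 K k) = kq_cycle K k.
Proof.
by apply/ffunP => v; rewrite kq_mulE [X in pact _ _ X]ffunE [RHS]ffunE;
  case: eqVneq => [->|_]; rewrite ?pact0 // pactXn ptarget_cycle ffunE eqxx mulr1.
Qed.

Lemma kq_cycle_mul0 g : kq_mul (kq_cycle K k) g ord0 = 'X^(k.+1) * g ord0.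
Proof. by rewrite kq_mulE ffunE eqxx pactXn ptarget_cycle. Qed.

(** Every nonzero term of the product gains a factor X^(k+1) with k+1 >= 1, so the order of
    vanishing rises by at least one. *)
Lemma kq_mul_cycle_coef g d :
  (forall v i, (i < d)%N -> (g v)`_i = 0) ->
  forall v i, (i < d.+1)%N -> (kq_mul g (kq_cycle K k) v)`_i = 0.
Proof.
move=> gd v i lt_id; rewrite kq_mulE /pact coef_sum big1 // => l _.
rewrite coefZ coefXnM ffunE; case: ltnP => [_|le_li]; first by rewrite mulr0.
case: ifP => _; last by rewrite coef0 mulr0.
rewrite coefXn; case: eqP => [il|_]; last by rewrite mulr0.
by rewrite gd ?mul0r //; lia.
Qed.

(** Each [q n] is a multiple of every power of the cycle, so its coefficients vanish in every
    degree. *)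
Lemma kq_cycle_divisible_eq0 (q : nat -> KQ) :
  (forall n, q n = kq_mul (q n.+1) (kq_cycle K k)) -> forall n, q n = 0.
Proof.
move=> qE.
have qd d : forall n v i, (i < d)%N -> (q n v)`_i = 0.
  elim: d => [//|d IH] n; rewrite qE.
  by apply: kq_mul_cycle_coef; apply: IH.
by move=> n; apply/ffunP => v; apply/polyP => i; rewrite ffunE coef0 (qd i.+1).
Qed.

Lemma KQmod_is_rmod : is_rmod (KQmod K k).
Proof.
do !split=> //=.
- by move=> x y z _ _ _; rewrite addrA.
- by move=> x y _ _; rewrite addrC.
- by move=> x _; rewrite add0r.
- by move=> x _; rewrite addNr.
- by move=> c x y _ _; rewrite scalerDr.
- by move=> c d x _; rewrite scalerDl.
- by move=> c d x _; rewrite scalerA.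
- by move=> x _; rewrite scale1r.
- by move=> x y r _ _; rewrite kq_mulDl.
- by move=> x r s _; rewrite kq_mulDr.
- by move=> x r s _; rewrite kq_mulA.
- by move=> x _; rewrite kq_mul1.
- by move=> c x r _; rewrite kq_mulZl.
- by move=> c x r _; rewrite kq_mulZr.
Qed.

End PathAlgebraTheory.

(** * Right modules *)

Section RightModuleTheory.
Variables (K : fieldType) (k : nat).
Local Notation KQ := (KQ K k).
Local Notation rmod := (rmod K k).

Section Elements.
Variables (M : rmod) (HM : is_rmod M).

Ltac rmod_axiom := unfold is_rmod in HM; decompose [and] HM; auto.

Lemma rmod0 : mem M (mzero M).
Proof. by rmod_axiom. Qed.
Lemma rmodD x y : mem M x -> mem M y -> mem M (madd M x y).
Proof. by rmod_axiom. Qed.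
Lemma rmodN x : mem M x -> mem M (mopp M x).
Proof. by rmod_axiom. Qed.
Lemma rmodZ c x : mem M x -> mem M (mscal M c x).
Proof. by rmod_axiom. Qed.
Lemma rmodM x r : mem M x -> mem M (mact M x r).
Proof. by rmod_axiom. Qed.
Lemma maddA x y z : mem M x -> mem M y -> mem M z ->
  madd M x (madd M y z) = madd M (madd M x y) z.
Proof. by rmod_axiom. Qed.
Lemma maddC x y : mem M x -> mem M y -> madd M x y = madd M y x.
Proof. by rmod_axiom. Qed.
Lemma madd0m x : mem M x -> madd M (mzero M) x = x.
Proof. by rmod_axiom. Qed.
Lemma maddNm x : mem M x -> madd M (mopp M x) x = mzero M.
Proof. by rmod_axiom. Qed.
Lemma mactDl x y r : mem M x -> mem M y ->
  mact M (madd M x y) r = madd M (mact M x r) (mact M y r).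
Proof. by rmod_axiom. Qed.
Lemma mactDr x r s : mem M x ->
  mact M x (r + s) = madd M (mact M x r) (mact M x s).
Proof. by rmod_axiom. Qed.
Lemma mactM x r s : mem M x -> mact M x (kq_mul r s) = mact M (mact M x r) s.
Proof. by rmod_axiom. Qed.
Lemma mact1 x : mem M x -> mact M x (kq_one K k) = x.
Proof. by rmod_axiom. Qed.
Lemma mactZ c x r : mem M x -> mact M x (c *: r) = mscal M c (mact M x r).
Proof. by rmod_axiom. Qed.

(* The axioms of [is_rmod] hold for members only, so the abelian group       *)
(* structure lives on the subtype of members.                                *)
Definition elt (_ : is_rmod M) : Type := {x : car M | mem M x}.
Local Notation T := (elt HM).

HB.instance Definition _ := gen_eqMixin T.
HB.instance Definition _ := gen_choiceMixin T.

Definition elt_add (x y : T) : T := exist _ _ (rmodD (svalP x) (svalP y)).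
Definition elt_opp (x : T) : T := exist _ _ (rmodN (svalP x)).
Definition elt_zero : T := exist _ _ rmod0.

Lemma elt_inj (x y : T) : sval x = sval y -> x = y.
Proof. by case: x y => x mx [y my] /= exy; apply: eq_exist. Qed.

Fact elt_addA : associative elt_add.
Proof. by move=> x y z; apply: elt_inj; apply: maddA; apply: svalP. Qed.
Fact elt_addC : commutative elt_add.
Proof. by move=> x y; apply: elt_inj; apply: maddC; apply: svalP. Qed.
Fact elt_add0 : left_id elt_zero elt_add.
Proof. by move=> x; apply: elt_inj; apply: madd0m; apply: svalP. Qed.
Fact elt_addN : left_inverse elt_zero elt_opp elt_add.
Proof. by move=> x; apply: elt_inj; apply: maddNm; apply: svalP. Qed.

HB.instance Definition _ :=
  GRing.isZmodule.Build T elt_addA elt_addC elt_add0 elt_addN.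

Definition toelt x (mx : mem M x) : T := exist _ x mx.

Definition elt_act (x : T) (r : KQ) : T := exist _ _ (rmodM r (svalP x)).

Lemma elt_actD r : {morph elt_act^~ r : x y / x + y}.
Proof. by move=> x y; apply: elt_inj; apply: mactDl; apply: svalP. Qed.

Lemma elt_actDr x : {morph elt_act x : r s / r + s}.
Proof. by move=> r s; apply: elt_inj; apply: mactDr; apply: svalP. Qed.

Lemma elt_act0 r : elt_act 0 r = 0.
Proof. by apply: (@addrI _ (elt_act 0 r)); rewrite -elt_actD !addr0. Qed.

Lemma elt_actr0 x : elt_act x 0 = 0.
Proof. by apply: (@addrI _ (elt_act x 0)); rewrite -elt_actDr !addr0. Qed.

Lemma elt_actM x r s : elt_act x (kq_mul r s) = elt_act (elt_act x r) s.
Proof. by apply: elt_inj; apply: mactM; apply: svalP. Qed.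

Lemma elt_act1 x : elt_act x (kq_one K k) = x.
Proof. by apply: elt_inj; apply: mact1; apply: svalP. Qed.

Lemma mact0 x : mem M x -> mact M x 0 = mzero M.
Proof. by move=> mx; apply: (congr1 sval (elt_actr0 (toelt mx))). Qed.

Lemma mact0m r : mact M (mzero M) r = mzero M.
Proof. by apply: (congr1 sval (elt_act0 r)). Qed.

(** Negation, like scalar multiplication in [mscalE], is the action of a ring element. Hence [hom]
    asks only for sums and actions, and submodules can be recognised by these alone. *)
Lemma moppE x : mem M x -> mopp M x = mact M x (- kq_one K k).
Proof.
move=> mx; suff /(congr1 sval) : - toelt mx = elt_act (toelt mx) (- kq_one K k) by [].
by apply: (@addIr _ (toelt mx)); rewrite addNr -{2}[toelt mx]elt_act1 -elt_actDr
  addNr elt_actr0.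
Qed.

Lemma mscalE c x : mem M x -> mscal M c x = mact M x (c *: kq_one K k).
Proof. by move=> mx; rewrite mactZ ?mact1. Qed.

Lemma msubmm x : mem M x -> madd M x (mopp M x) = mzero M.
Proof. by move=> mx; apply: (congr1 sval (subrr (toelt mx))). Qed.

Lemma msubm0 x : mem M x -> madd M x (mopp M (mzero M)) = x.
Proof. by move=> mx; apply: (congr1 sval (subr0 (toelt mx))). Qed.

Lemma msubKm x y : mem M x -> mem M y -> madd M (madd M x (mopp M y)) y = x.
Proof. by move=> mx my; apply: (congr1 sval (subrK (toelt my) (toelt mx))). Qed.

Lemma moppB x y : mem M x -> mem M y ->
  mopp M (madd M x (mopp M y)) = madd M y (mopp M x).
Proof. by move=> mx my; apply: (congr1 sval (opprB (toelt mx) (toelt my))). Qed.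

Lemma msub_trans x y z : mem M x -> mem M y -> mem M z ->
  madd M x (mopp M z) = madd M (madd M x (mopp M y)) (madd M y (mopp M z)).
Proof.
move=> mx my mz; apply: (congr1 sval (_ : toelt mx - toelt mz =
  (toelt mx - toelt my) + (toelt my - toelt mz))).
by rewrite addrA subrK.
Qed.

Lemma maddACA x y z t : mem M x -> mem M y -> mem M z -> mem M t ->
  madd M (madd M x y) (madd M z t) = madd M (madd M x z) (madd M y t).
Proof.
by move=> mx my mz mt; apply: (congr1 sval
  (addrACA (toelt mx) (toelt my) (toelt mz) (toelt mt))).
Qed.

Lemma msubACA x y z t : mem M x -> mem M y -> mem M z -> mem M t ->
  madd M (madd M x y) (mopp M (madd M z t)) =
  madd M (madd M x (mopp M z)) (madd M y (mopp M t)).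
Proof.
move=> mx my mz mt; apply: (congr1 sval (_ : (toelt mx + toelt my) -
  (toelt mz + toelt mt) = (toelt mx - toelt mz) + (toelt my - toelt mt))).
by rewrite opprD addrACA.
Qed.

Lemma mact_opp x r : mem M x -> mact M (mopp M x) r = mopp M (mact M x r).
Proof.
move=> mx; apply: (congr1 sval (_ : elt_act (- toelt mx) r = - elt_act (toelt mx) r)).
by apply: (@addIr _ (elt_act (toelt mx) r)); rewrite -elt_actD !addNr elt_act0.
Qed.

Lemma moppK x : mem M x -> mopp M (mopp M x) = x.
Proof. by move=> mx; apply: (congr1 sval (opprK (toelt mx))). Qed.

End Elements.

End RightModuleTheory.

(** * Homomorphisms, spans, and lifting along projectives *)

Section SubmodulesAndMorphisms.
Variables (K : fieldType) (k : nat).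
Local Notation rmod := (rmod K k).
Implicit Types M N L P A B : rmod.

Lemma hom0 M N f : is_rmod M -> is_rmod N -> @hom K k M N f ->
  f (mzero M) = mzero N.
Proof.
move=> HM HN [fm _ fa]; have m0 := rmod0 HM.
by rewrite -(mact0 HM m0) fa // mact0 //; apply: fm.
Qed.

Lemma homN M N f x : is_rmod M -> is_rmod N -> @hom K k M N f -> mem M x ->
  f (mopp M x) = mopp N (f x).
Proof. by move=> HM HN [fm _ fa] mx; rewrite !moppE ?fa //; apply: fm. Qed.

Lemma homB M N f x y : is_rmod M -> is_rmod N -> @hom K k M N f ->
  mem M x -> mem M y -> f (madd M x (mopp M y)) = madd N (f x) (mopp N (f y)).
Proof.
move=> HM HN hf mx my; have [fm fD _] := hf.
by rewrite fD ?(homN HM HN) //; apply: rmodN.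
Qed.

Lemma hom_comp M N L f g : @hom K k M N f -> @hom K k N L g ->
  @hom K k M L (fun x => g (f x)).
Proof.
move=> [fm fD fa] [gm gD ga]; split=> [x mx|x y mx my|x r mx].
- exact/gm/fm.
- by rewrite fD // gD //; apply: fm.
- by rewrite fa // ga //; apply: fm.
Qed.

Lemma hom_add M N f g : is_rmod N -> @hom K k M N f -> @hom K k M N g ->
  @hom K k M N (fun x => madd N (f x) (g x)).
Proof.
move=> HN [fm fD fa] [gm gD ga]; split=> [x mx|x y mx my|x r mx].
- by apply: rmodD; auto.
- by rewrite fD // gD // maddACA //; auto.
- by rewrite fa // ga // mactDl //; auto.
Qed.

Lemma hom_sub M N f g : is_rmod N -> @hom K k M N f -> @hom K k M N g ->
  @hom K k M N (fun x => madd N (f x) (mopp N (g x))).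
Proof.
move=> HN [fm fD fa] [gm gD ga]; split=> [x mx|x y mx my|x r mx].
- by apply: rmodD; auto; apply: rmodN; auto.
- by rewrite fD // gD // msubACA //; auto.
- by rewrite fa // ga // mactDl ?mact_opp //; auto; apply: rmodN; auto.
Qed.

Lemma hom_restrict M N f (S : car M -> Prop) : (forall x, S x -> mem M x) ->
  @hom K k M N f -> @hom K k (restrict S) N f.
Proof.
move=> SM [fm fD fa]; split=> /= [x /SM|x y /SM mx /SM|x r /SM]; auto.
Qed.

Lemma submod_of_act M (S : car M -> Prop) : is_rmod M ->
  (forall x, S x -> mem M x) -> S (mzero M) ->
  (forall x y, S x -> S y -> S (madd M x y)) ->
  (forall x r, S x -> S (mact M x r)) -> is_submod S.
Proof.
move=> HM SM S0 SD SA; split=> //; split=> //; split=> //.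
split=> [x Sx|]; first by rewrite moppE //; auto.
by split=> // c x Sx; rewrite mscalE //; auto.
Qed.

Lemma restrict_is_rmod M (S : car M -> Prop) :
  is_rmod M -> is_submod S -> is_rmod (restrict S).
Proof.
move=> HM [SM [S0 [SD [SN [SZ SA]]]]]; unfold is_rmod in HM.
decompose [and] HM; unfold is_rmod; simpl; repeat split; auto.
Qed.

Lemma span_gen M (G : car M -> Prop) x : mem M x -> G x -> span G x.
Proof. by move=> mx Gx; split=> // S _; apply. Qed.

Lemma span_is_submod M (G : car M -> Prop) : is_rmod M -> is_submod (span G).
Proof.
move=> HM; apply: submod_of_act => //.
- by move=> x [].
- by split=> [|S [_ [S0 _]] _] //; apply: rmod0.
- move=> x y [mx Sx] [my Sy]; split=> [|S HS GS]; first exact: rmodD.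
  have [_ [_ [SD _]]] := HS.
  by apply: SD; [apply: Sx|apply: Sy].
- move=> x r [mx Sx]; split=> [|S HS GS]; first exact: rmodM.
  have [_ [_ [_ [_ [_ SA]]]]] := HS.
  by apply: SA; apply: Sx.
Qed.

Lemma span_sub M (G S : car M -> Prop) : is_submod S ->
  (forall x, G x -> S x) -> forall x, span G x -> S x.
Proof. by move=> HS GS x [_]; apply. Qed.

(** Two homomorphisms that agree on generators agree on the span, by minimality of the span. The
    same lemma builds the pullback in [projective_lift]. *)
Lemma equalizer_is_submod M N f g : is_rmod M -> is_rmod N ->
  @hom K k M N f -> @hom K k M N g ->
  is_submod (fun x => mem M x /\ f x = g x).
Proof.
move=> HM HN hf hg; have [fm fD fa] := hf; have [gm gD ga] := hg.
apply: submod_of_act => //.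
- by move=> x [].
- by split; [apply: rmod0|rewrite (hom0 HM HN hf) (hom0 HM HN hg)].
- by move=> x y [mx ex] [my ey]; split; [apply: rmodD|rewrite fD // gD // ex ey].
- by move=> x r [mx ex]; split; [apply: rmodM|rewrite fa // ga // ex].
Qed.

Definition prodmod M N : rmod :=
  @RMod K k (car M * car N)%type (fun x => mem M x.1 /\ mem N x.2)
    (mzero M, mzero N) (fun x y => (madd M x.1 y.1, madd N x.2 y.2))
    (fun x => (mopp M x.1, mopp N x.2)) (fun c x => (mscal M c x.1, mscal N c x.2))
    (fun x r => (mact M x.1 r, mact N x.2 r)).

Lemma prodmod_is_rmod M N : is_rmod M -> is_rmod N -> is_rmod (prodmod M N).
Proof.
rewrite /is_rmod => HM HN; decompose [and] HM; decompose [and] HN.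
do ?split=> /=; intros;
  repeat match goal with x : (_ * _)%type |- _ => destruct x end; simpl in *;
  repeat match goal with H : _ /\ _ |- _ => destruct H end;
  try (by auto); f_equal; auto.
Qed.

(** Projectivity is defined by splitting, so the lift is the second component of a section of the
    pullback of [p] and [q] over P. Only the image of [q] has to be covered by [p], which suits maps
    into kernels. *)
Lemma projective_lift P A B (p : car A -> car B) (q : car P -> car B) :
  is_rmod P -> projective P -> is_rmod A -> is_rmod B -> hom p -> hom q ->
  (forall x, mem P x -> exists a, mem A a /\ p a = q x) ->
  exists l : car P -> car A, hom l /\ forall x, mem P x -> p (l x) = q x.
Proof.
move=> HP pP HA HB hp hq onto; have [pm pD pa] := hp; have [qm qD qa] := hq.
have HPA := prodmod_is_rmod HP HA.
pose S (z : car (prodmod P A)) := mem (prodmod P A) z /\ q z.1 = p z.2.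
have HS : is_submod S.
  apply: (@equalizer_is_submod (prodmod P A) B (fun z => q z.1) (fun z => p z.2)) => //;
  by split=> [x []|x y [? ?] [? ?]|x r [? ?]] /=; auto.
have [|y my|s [[sm sD sa] sE]] :=
  pP (restrict S) fst (restrict_is_rmod HPA HS).
- by split=> //= x [[]].
- by have [a [ma pE]] := onto y my; exists (y, a).
exists (fun x => (s x).2); split.
  split=> [x mx|x y mx my|x r mx]; first by have [[_]] := sm x mx.
    by rewrite sD.
  by rewrite sa.
by move=> x mx; have [_ <-] := sm x mx; rewrite sE.
Qed.

(** * Quotients as sets of cosets, computed on representatives *)

Section Quotient.
Variables (M : rmod) (S : car M -> Prop).
Hypotheses (HM : is_rmod M) (HS : is_submod S).
Let SM x : S x -> mem M x. Proof. by case: HS => + _; apply. Qed.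
Let S0 : S (mzero M). Proof. by case: HS => _ []. Qed.
Let SD x y : S x -> S y -> S (madd M x y).
Proof. by case: HS => _ [_ [+ _]]; apply. Qed.
Let SN x : S x -> S (mopp M x).
Proof. by case: HS => _ [_ [_ [+ _]]]; apply. Qed.
Let SA x r : S x -> S (mact M x r).
Proof. by case: HS => _ [_ [_ [_ [_ +]]]]; apply. Qed.
Local Notation Q := (quotient S).
Local Notation cl := (cls S).
Local Hint Resolve rmod0 rmodD rmodN rmodZ rmodM : core.

Lemma mem_cls x : mem M x -> mem Q (cl x).
Proof. by exists x. Qed.

Lemma cls_refl x : mem M x -> cl x x.
Proof. by move=> mx; split=> //; rewrite msubmm. Qed.

Lemma cls_zeroP x : mem M x -> (cl x = mzero Q) <-> S x.
Proof.
move=> mx; split=> [e|Sx].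
  by have := cls_refl mx; rewrite e => -[_]; rewrite msubm0.
apply/predeqP => y; split=> -[my Sy]; split=> //.
  by rewrite msubm0 // -(msubKm HM my mx); auto.
by apply: SD; [rewrite -(msubm0 HM my)|apply: SN].
Qed.

Lemma madd_cls x y : mem M x -> mem M y -> madd Q (cl x) (cl y) = cl (madd M x y).
Proof.
move=> mx my; apply/predeqP => z; split.
  move=> [mz [a [b [[ma Sa] [[mb Sb] Sz]]]]]; split=> //.
  by rewrite (@msub_trans _ _ _ HM z (madd M a b)) ?msubACA //; auto.
move=> [mz Sz]; split=> //; exists x, y.
by split; [apply: cls_refl|split; [apply: cls_refl|]].
Qed.

Lemma mopp_cls x : mem M x -> mopp Q (cl x) = cl (mopp M x).
Proof.
move=> mx; apply/predeqP => z; split.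
  move=> [mz [a [[ma Sa] Sz]]]; split=> //.
  rewrite (@msub_trans _ _ _ HM z (mopp M a)) ?moppK //; auto.
  by apply: SD => //; rewrite maddC -1?moppB //; auto.
move=> [mz]; rewrite moppK // => Sz; split=> //; exists x.
by split; first exact: cls_refl.
Qed.

Lemma mact_cls x r : mem M x -> mact Q (cl x) r = cl (mact M x r).
Proof.
move=> mx; apply/predeqP => z; split.
  move=> [mz [a [[ma Sa] Sz]]]; split=> //.
  rewrite (@msub_trans _ _ _ HM z (mact M a r)) //; auto.
  by apply: SD => //; rewrite -mact_opp // -mactDl //; auto.
by move=> [mz Sz]; split=> //; exists x; split; first exact: cls_refl.
Qed.

Lemma mscal_cls c x : mem M x -> mscal Q c (cl x) = cl (mscal M c x).
Proof.
move=> mx; rewrite (mscalE HM) // -mact_cls //.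
apply/predeqP => z; split=> -[mz [a [[ma Sa] Sz]]]; split=> //; exists a;
  by split=> //; move: Sz; rewrite (mscalE HM).
Qed.

Lemma quotient_is_rmod : is_rmod Q.
Proof.
have := HM; rewrite /is_rmod => H; decompose [and] H.
do 18?[split]; first exact: mem_cls.
- by move=> _ _ [x [mx ->]] [y [my ->]]; rewrite madd_cls //; apply: mem_cls; auto.
- by move=> _ [x [mx ->]]; rewrite mopp_cls //; apply: mem_cls; auto.
- by move=> c _ [x [mx ->]]; rewrite mscal_cls //; apply: mem_cls; auto.
- by move=> _ r [x [mx ->]]; rewrite mact_cls //; apply: mem_cls; auto.
- move=> _ _ _ [x [mx ->]] [y [my ->]] [z [mz ->]].
  by rewrite !madd_cls ?maddA //; auto.
- by move=> _ _ [x [mx ->]] [y [my ->]]; rewrite !madd_cls // maddC.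
- by move=> _ [x [mx ->]]; rewrite /mzero madd_cls ?madd0m //; auto.
- by move=> _ [x [mx ->]]; rewrite mopp_cls // madd_cls ?maddNm //; auto.
- move=> c _ _ [x [mx ->]] [y [my ->]].
  by rewrite !(mscal_cls, madd_cls) //; auto; congr (cls S _); auto.
- move=> c d _ [x [mx ->]].
  by rewrite !(mscal_cls, madd_cls) //; auto; congr (cls S _); auto.
- by move=> c d _ [x [mx ->]]; rewrite !mscal_cls //; auto; congr (cls S _); auto.
- by move=> _ [x [mx ->]]; rewrite mscal_cls //; congr (cls S _); auto.
- move=> _ _ r [x [mx ->]] [y [my ->]].
  by rewrite !(mact_cls, madd_cls) ?mactDl //; auto.
- by move=> _ r s [x [mx ->]]; rewrite !(mact_cls, madd_cls) ?mactDr //; auto.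
- by move=> _ r s [x [mx ->]]; rewrite !mact_cls ?mactM //; auto.
- by move=> _ [x [mx ->]]; rewrite mact_cls ?mact1.
- move=> c _ r [x [mx ->]].
  by rewrite !(mscal_cls, mact_cls) //; auto; congr (cls S _); auto.
- by move=> c _ r [x [mx ->]]; rewrite !(mscal_cls, mact_cls) ?mactZ //; auto.
Qed.

Lemma hom_cls : @hom K k M Q cl.
Proof.
split=> [x|x y mx my|x r mx]; first exact: mem_cls.
  by rewrite madd_cls.
by rewrite mact_cls.
Qed.

End Quotient.
End SubmodulesAndMorphisms.

(** * The free module F *)

Section FreeModule.
Variables (K : fieldType) (k : nat).
Local Notation KQ := (KQ K k).

Section Support.
Variables (O : Type) (lt : O -> O -> Prop).
Local Notation Fmod := (@Fmod K k O lt).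
Implicit Types (x y : Amb K k O) (g xi : O) (m n : nat).

Lemma amb_ext x y : (forall xi n, x xi n = y xi n) -> x = y.
Proof. by move=> e; apply/funext => xi; apply/funext => n. Qed.

Lemma F_mem_sub x y : (forall xi n, x xi n = 0 -> y xi n = 0) ->
  F_mem lt x -> F_mem lt y.
Proof.
move=> xy [[s sx] lx]; split.
  by exists s => xi n ynz; apply: sx => x0; apply/ynz/xy.
by move=> xi n nl nz; apply/xy/lx.
Qed.

Lemma F_memD x y : F_mem lt x -> F_mem lt y -> F_mem lt (madd Fmod x y).
Proof.
move=> [[s sx] lx] [[t ty] ly]; split=> [|xi n nl nz] /=; last by rewrite lx ?ly ?addr0.
exists (s ++ t) => xi n nz; apply/List.in_or_app.
have [x0|/eqP/sx] := eqVneq (x xi n) 0; last by left.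
by right; apply: ty => y0; apply: nz; rewrite x0 y0 addr0.
Qed.

Lemma Fmod_is_rmod : is_rmod Fmod.
Proof.
rewrite /is_rmod /=.
split; first by split=> //; exists nil.
split; first exact: F_memD.
split; first by move=> x; apply: F_mem_sub => xi n ->; rewrite oppr0.
split; first by move=> c x; apply: F_mem_sub => xi n ->; rewrite scaler0.
split; first by move=> x r; apply: F_mem_sub => xi n ->; rewrite kq_0mul.
split; first by move=> x y z _ _ _; apply: amb_ext => xi n; rewrite addrA.
split; first by move=> x y _ _; apply: amb_ext => xi n; rewrite addrC.
split; first by move=> x _; apply: amb_ext => xi n; rewrite add0r.
split; first by move=> x _; apply: amb_ext => xi n; rewrite addNr.
split; first by move=> c x y _ _; apply: amb_ext => xi n; rewrite scalerDr.
split; first by move=> c d x _; apply: amb_ext => xi n; rewrite scalerDl.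
split; first by move=> c d x _; apply: amb_ext => xi n; rewrite scalerA.
split; first by move=> x _; apply: amb_ext => xi n; rewrite scale1r.
split; first by move=> x y r _ _; apply: amb_ext => xi n; rewrite kq_mulDl.
split; first by move=> x r s _; apply: amb_ext => xi n; rewrite kq_mulDr.
split; first by move=> x r s _; apply: amb_ext => xi n; rewrite kq_mulA.
split; first by move=> x _; apply: amb_ext => xi n; rewrite kq_mul1.
split; first by move=> c x r _; apply: amb_ext => xi n; rewrite kq_mulZl.
by move=> c x r _; apply: amb_ext => xi n; rewrite kq_mulZr.
Qed.

Lemma unitvE g m (r : KQ) : unitv g m r g m = r.
Proof. by rewrite /unitv; case: excluded_middle_informative => // -[]. Qed.

Lemma unitv_neq g m (r : KQ) xi n : ~ (xi = g /\ n = m) -> unitv g m r xi n = 0.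
Proof. by rewrite /unitv; case: excluded_middle_informative. Qed.

Lemma F_mem_unitv g m (r : KQ) : is_limit lt g \/ m = 0%N -> F_mem lt (unitv g m r).
Proof.
move=> gm; split.
  exists [:: (g, m)] => xi n nz; left; apply: contra_notP nz => nz.
  by rewrite unitv_neq // => -[gE mE]; apply: nz; rewrite gE mE.
move=> xi n nl nz; apply: unitv_neq => -[gE mE].
by case: gm; rewrite -?gE -?mE.
Qed.

Lemma unitv_act g m (r s : KQ) : mact Fmod (unitv g m r) s = unitv g m (kq_mul r s).
Proof.
apply: amb_ext => xi n /=; have [[-> ->]|ne] := EM (xi = g /\ n = m).
  by rewrite !unitvE.
by rewrite !unitv_neq // kq_0mul.
Qed.

End Support.

Section FreeMapEqType.
Variables (O : eqType) (lt : O -> O -> Prop) (N : rmod K k).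
Variables (HN : is_rmod N) (p : O -> nat -> elt HN).
Implicit Types (x y : Amb K k O) (s : seq (O * nat)).

Let term x (j : O * nat) : elt HN := elt_act (p j.1 j.2) (x j.1 j.2).
Let total s x := \sum_(j <- s) term x j.
Let covers s x := forall j : O * nat, x j.1 j.2 != 0 -> j \in s.

Let term0 x j : x j.1 j.2 = 0 -> term x j = 0.
Proof. by move=> x0; rewrite /term x0 elt_actr0. Qed.

Let total_eq s t x : uniq s -> uniq t -> covers s x -> covers t x ->
  total s x = total t x.
Proof.
have nzE u : total u x = \sum_(j <- u | x j.1 j.2 != 0) term x j.
  by rewrite big_mkcond; apply: eq_bigr => j _; case: eqP => // /term0.
move=> us ut sx tx; rewrite !nzE -[LHS]big_filter -[RHS]big_filter.
apply/perm_big/uniq_perm; rewrite ?filter_uniq // => j; rewrite !mem_filter.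
by case: (boolP (_ != 0)) => //= nz; rewrite sx // tx.
Qed.

Let exists_cover x : exists s, F_mem lt x -> covers s x.
Proof.
have [Fx|nFx] := EM (F_mem lt x); last by exists [::].
case: Fx => -[s sx] _; exists s => _ [xi n] /eqP/sx.
by elim: s {sx} => //= j s IH [->|/IH]; rewrite inE ?eqxx // => ->; rewrite orbT.
Qed.

(** The universal property of F. The value at x is a sum over a chosen finite list covering the
    support of x; by [total_eq] the list does not matter, so x, y and x + y can be evaluated over a
    common one. Removing repetitions needs decidable equality on [O], which [free_map] obtains from
    [{classic O}]. *)
Lemma free_map_eqType : exists u : Amb K k O -> car N,
  @hom K k (Fmod K k lt) N u /\
  forall xi n r, F_mem lt (unitv xi n r) -> u (unitv xi n r) = mact N (sval (p xi n)) r.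
Proof.
have [c cP] := choice exists_cover.
pose u x := total (undup (c x)) x.
have uE s x : F_mem lt x -> uniq s -> covers s x -> u x = total s x.
  move=> Fx us sx; apply: total_eq; rewrite ?undup_uniq // => j nz.
  by rewrite mem_undup; apply: cP.
exists (fun x => sval (u x)); split; last first.
  move=> xi n r Fx; rewrite (uE [:: (xi, n)]) //.
    by rewrite /total big_seq1 /term /= unitvE.
  move=> [g m] /= /eqP nz; rewrite inE; apply: contra_notT nz => ne.
  by apply: unitv_neq => -[gE mE]; rewrite gE mE eqxx in ne.
split=> [x _|x y Fx Fy|x r Fx]; first exact: svalP.
  rewrite -[madd N _ _]/(sval (u x + u y)); congr (sval _).
  pose s := undup (c x ++ c y).
  have sx : covers s x by move=> j nz; rewrite mem_undup mem_cat (cP x).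
  have sy : covers s y by move=> j nz; rewrite mem_undup mem_cat (cP y) ?orbT.
  rewrite !(uE s) ?undup_uniq // /total.
  - by rewrite -big_split; apply: eq_bigr => j _; rewrite /term /= elt_actDr.
  - exact: F_memD.
  - move=> j /= nz; have [x0|/sx //] := eqVneq (x j.1 j.2) 0.
    by apply: sy; rewrite x0 add0r in nz.
rewrite -[mact N _ _]/(sval (elt_act (u x) r)); congr (sval _).
have cx : covers (undup (c x)) x by move=> j nz; rewrite mem_undup (cP x).
rewrite !(uE (undup (c x))) ?undup_uniq // /total.
- rewrite (big_morph _ (@elt_actD _ _ _ HN r) (elt_act0 HN r)).
  by apply: eq_bigr => j _; rewrite /term /= elt_actM.
- exact: (rmodM (Fmod_is_rmod lt)).
- move=> j /= nz; apply: cx; apply: contraNneq nz => ->; by rewrite kq_0mul.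
Qed.

End FreeMapEqType.

Lemma free_map (O : Type) (lt : O -> O -> Prop) (N : rmod K k)
    (p : O -> nat -> car N) : is_rmod N -> (forall xi n, mem N (p xi n)) ->
  exists u : Amb K k O -> car N, @hom K k (Fmod K k lt) N u /\
    forall xi n r, F_mem lt (unitv xi n r) -> u (unitv xi n r) = mact N (p xi n) r.
Proof.
move=> HN mp.
exact: (@free_map_eqType {classic O} lt N HN (fun xi n => toelt HN (mp xi n))).
Qed.

End FreeModule.

(** * The module of the ladder system *)

Section LadderModule.
Variables (K : fieldType) (k : nat) (O : Type) (lt : O -> O -> Prop).
Variables (C : O -> nat -> O).
Hypothesis (goodC : good_ladder lt C).
Local Notation KQ := (KQ K k).
Local Notation F := (Fmod K k lt).
Local Notation e0 := (kq_e0 K k).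
Local Notation cyc := (kq_cycle K k).
Local Notation I := (I_sub lt C).
Local Notation gen := (Ggen K k lt C).
Local Notation M := (M_omega1 K k lt C).
Local Notation limit := (is_limit lt).
Implicit Types (x y : Amb K k O) (a g xi : O) (n m : nat).

Let HF : is_rmod F := Fmod_is_rmod K k lt.

(** Points of a good ladder have the form delta + n + 1, so they are successors. This keeps the term
    [e_succ (C a n)] of a generator out of all limit rows. *)
Lemma ladder_not_limit a n : limit a -> ~ limit (C a n).
Proof.
move=> la; have [_ /(_ a n la) [d [_ [_ [y [_ succ_y]]]]]] := goodC.
by case=> _ /(_ y).
Qed.

Definition basis x : Prop :=
  (exists g, ~ limit g /\ x = e_succ K k g) \/
  (exists a n, limit a /\ x = e_lim K k a n).

Lemma F_mem_e_succ g : F_mem lt (e_succ K k g).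
Proof. by apply: F_mem_unitv; right. Qed.

Lemma F_mem_e_lim a n : limit a -> F_mem lt (e_lim K k a n).
Proof. by move=> la; apply: F_mem_unitv; left. Qed.

Lemma F_mem_basis x : basis x -> mem F x.
Proof.
by case=> [[g [_ ->]]|[a [n [la ->]]]]; [apply: F_mem_e_succ|apply: F_mem_e_lim].
Qed.

Definition Fbase : Amb K k O -> Prop := @span K k F basis.

Lemma Fbase_is_submod : @is_submod K k F Fbase.
Proof. exact: span_is_submod. Qed.

Lemma Fbase_mem x : Fbase x -> mem F x.
Proof. by case. Qed.

Lemma Fbase_basis x : basis x -> Fbase x.
Proof. by move=> bx; apply: span_gen => //; apply: F_mem_basis. Qed.

Lemma I_is_submod : @is_submod K k F I.
Proof. exact: span_is_submod. Qed.

Lemma genE a n xi m : gen a n xi m =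
  e_succ K k (C a n) xi m - e_lim K k a n xi m + kq_mul (e_lim K k a n.+1 xi m) cyc.
Proof. by []. Qed.

Lemma F_mem_gen a n : limit a -> mem F (gen a n).
Proof.
move=> la; do 2?[apply: (rmodD HF)].
- exact: F_mem_e_succ.
- exact/(rmodN HF)/F_mem_e_lim.
- exact/(rmodM HF)/F_mem_e_lim.
Qed.

Lemma I_gen a n : limit a -> I (gen a n).
Proof.
move=> la; have mg := F_mem_gen n la.
apply: span_gen => //; exists a; split=> //.
by apply: span_gen => //; exists n.
Qed.

Lemma I_sub_of_gen (S : Amb K k O -> Prop) : @is_submod K k F S ->
  (forall a n, limit a -> S (gen a n)) -> forall x, I x -> S x.
Proof.
move=> HS Sg; apply: (@span_sub _ _ F) => // x [a [la]].
by apply: (@span_sub _ _ F) => // _ [n ->]; apply: Sg.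
Qed.

Lemma Fbase_gen a n : limit a -> Fbase (gen a n).
Proof.
move=> la; have [_ [_ [SD [SN [_ SA]]]]] := Fbase_is_submod.
apply: (SD); [apply: (SD); [|apply: SN]|apply: SA]; apply: Fbase_basis.
- by left; exists (C a n); split=> //; apply: ladder_not_limit.
- by right; exists a, n.
- by right; exists a, n.+1.
Qed.

Lemma basis_e0 x : basis x -> mact F x e0 = x.
Proof.
case=> [[g [_ ->]]|[a [n [_ ->]]]];
by rewrite /e_succ /e_lim unitv_act kq_e0_e0.
Qed.

(** A map prescribed by [free_map] with value p at a coordinate sends the vector e_0 there to p e_0;
    this identity absorbs the extra factor. *)
Lemma gen_e0 a n : limit a -> mact F (gen a n) e0 = gen a n.
Proof.
move=> la; apply: amb_ext => xi m /=.
have e0K g i : kq_mul (unitv g i e0 xi m) e0 = unitv g i e0 xi m.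
  by rewrite -[LHS]/(mact F (unitv g i e0) e0 xi m) unitv_act kq_e0_e0.
by rewrite !kq_mulDl kq_Nmul -kq_mulA kq_cycle_e0 !e0K.
Qed.

Let HQ : is_rmod (FmodI K k lt C) := quotient_is_rmod HF I_is_submod.

Lemma M_is_rmod : is_rmod M.
Proof. by apply: restrict_is_rmod => //; apply: span_is_submod. Qed.

(** Both inclusions are minimality of a span: the image of [Fbase] is a submodule of F/I, and the
    preimage of M is a submodule of F. *)
Lemma mem_MP D : mem M D <-> exists x, Fbase x /\ D = @cls K k F I x.
Proof.
have HI := I_is_submod.
have HM' := span_is_submod (@M_gens K k O lt C) HQ.
have [BM [B0 [BD [_ [_ BA]]]]] := Fbase_is_submod.
split.
  apply: (@span_sub _ _ (FmodI K k lt C) (@M_gens K k O lt C)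
    (fun D => exists x, Fbase x /\ D = @cls K k F I x)); last first.
    by move=> _ [x [bx ->]]; exists x; split=> //; apply: Fbase_basis.
  apply: submod_of_act => //.
  - by move=> _ [x [/BM mx ->]]; apply: mem_cls.
  - by exists (mzero F).
  - move=> _ _ [x [bx ->]] [y [bY ->]]; exists (madd F x y).
    by split; [apply: BD|rewrite /FmodI madd_cls //; apply: BM].
  - move=> _ r [x [bx ->]]; exists (mact F x r).
    by split; [apply: BA|rewrite /FmodI mact_cls //; apply: BM].
have [SM [S0 [SD [_ [_ SA]]]]] := HM'.
suff bM x : Fbase x -> mem F x /\ mem M (@cls K k F I x) by move=> [x [/bM[_ +] ->]].
apply: (@span_sub _ _ F basis
  (fun y => mem F y /\ mem M (@cls K k F I y))) x; last first.
  move=> x bx; have mx := F_mem_basis bx; split=> //.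
  by apply: span_gen; [apply: mem_cls|exists x].
apply: submod_of_act => //.
- by move=> x [].
- by split; [apply: rmod0|].
- move=> x y [mx cx] [my cy]; split; first exact: rmodD.
  by have := SD _ _ cx cy; rewrite /FmodI madd_cls.
- move=> x r [mx cx]; split; first exact: rmodM.
  by have := SA _ r cx; rewrite /FmodI mact_cls.
Qed.

Lemma hom_proj : @hom K k (@restrict K k F Fbase) M (@cls K k F I).
Proof.
have [cm cD ca] := hom_cls HF I_is_submod.
split=> /= [x bx|x y /Fbase_mem mx /Fbase_mem my|x r /Fbase_mem mx].
- by apply/mem_MP; exists x.
- exact: cD.
- exact: ca.
Qed.

Lemma proj_eq0 x : Fbase x -> (@cls K k F I x = mzero M) <-> I x.
Proof. by move=> /Fbase_mem mx; apply: (cls_zeroP HF I_is_submod). Qed.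

(* [psi] computes the coefficients of an element of [I] with respect to the  *)
(* generators [gen a n]: if [x] is the sum of the [gen a n * r_n], then its  *)
(* [(a, n)]-coordinate is [cyc * r_(n-1) - e0 * r_n].                        *)
Fixpoint psi_rec (y : nat -> KQ) n : KQ :=
  if n is n'.+1 then - y n + kq_mul cyc (psi_rec y n') else - y 0%N.

Definition psi x : Amb K k O := fun a n =>
  if excluded_middle_informative (limit a) then psi_rec (x a) n else 0.

Lemma psi_limit x a n : limit a -> psi x a n = psi_rec (x a) n.
Proof. by rewrite /psi; case: excluded_middle_informative. Qed.

Lemma psi_nonlimit x a n : ~ limit a -> psi x a n = 0.
Proof. by rewrite /psi; case: excluded_middle_informative. Qed.

Lemma psiD x y : psi (madd F x y) = madd F (psi x) (psi y).
Proof.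
apply: amb_ext => a n /=; have [la|nla] := EM (limit a); last first.
  by rewrite !psi_nonlimit // addr0.
rewrite !psi_limit //; elim: n => [|n IH] /=; first by rewrite opprD.
by rewrite IH kq_mulDr opprD addrACA.
Qed.

Lemma psiM x r : psi (mact F x r) = mact F (psi x) r.
Proof.
apply: amb_ext => a n /=; have [la|nla] := EM (limit a); last first.
  by rewrite !psi_nonlimit // kq_0mul.
rewrite !psi_limit //; elim: n => [|n IH] /=; first by rewrite kq_Nmul.
by rewrite IH kq_mulA kq_mulDl kq_Nmul.
Qed.

Lemma psi_rec0 (y : nat -> KQ) n :
  (forall m, (m <= n)%N -> y m = 0) -> psi_rec y n = 0.
Proof.
elim: n => [|n IH] y0 /=; first by rewrite y0 ?oppr0.
by rewrite y0 // IH ?kq_mul0 ?oppr0 ?addr0 // => m mn; apply: y0; lia.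
Qed.

(** Row a of the generator is -e_0 in column n and the cycle in column n+1. The recursion turns the
    first into e_0; in the next column the cycle cancels against cycle * e_0, and only zeros
    follow. *)
Lemma psi_gen a n : limit a -> psi (gen a n) = e_lim K k a n.
Proof.
move=> la; apply: amb_ext => xi m.
have Cxi l : limit xi -> e_succ K k (C a n) xi l = 0.
  move=> lxi; apply: unitv_neq => -[xiE _].
  by apply: (@ladder_not_limit a n) => //; rewrite -xiE.
have [lxi|nlxi] := EM (limit xi); last first.
  rewrite psi_nonlimit // /e_lim unitv_neq // => -[xiE _].
  by apply: nlxi; rewrite xiE.
rewrite psi_limit //; have [xiE|xia] := EM (xi = a); last first.
  rewrite psi_rec0; first by rewrite /e_lim unitv_neq // => -[].
  by move=> l _; rewrite genE Cxi // /e_lim !unitv_neq ?kq_0mul ?oppr0 ?addr0 // => -[].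
rewrite {xi}xiE in lxi Cxi *.
have coefE l : gen a n a l = (if l == n then - e0 else 0) + (if l == n.+1 then cyc else 0).
  rewrite genE Cxi // add0r; congr (_ + _).
    case: eqP => [->|ne]; first by rewrite /e_lim unitvE.
    by rewrite /e_lim unitv_neq ?oppr0 // => -[].
  case: eqP => [->|ne]; first by rewrite /e_lim unitvE kq_e0_cycle.
  by rewrite /e_lim unitv_neq ?kq_0mul // => -[].
have low l : (l < n)%N -> psi_rec (gen a n a) l = 0.
  move=> ln; apply: psi_rec0 => i il; rewrite coefE.
  by rewrite !ifF ?addr0 //; apply/eqP; lia.
have mid : psi_rec (gen a n a) n = e0.
  clear Cxi; case: n => [|n] in coefE low *.
    by rewrite -[LHS]/(- gen a 0 a 0) coefE eqxx /= addr0 opprK.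
  rewrite -[LHS]/(- gen a n.+1 a n.+1 + kq_mul cyc (psi_rec (gen a n.+1 a) n)).
  by rewrite low // kq_mul0 coefE eqxx ifF ?addr0 ?opprK //; apply/eqP; lia.
have high l : psi_rec (gen a n a) (n.+1 + l) = 0.
  elim: l => [|l IH].
    rewrite addn0 -[LHS]/(- gen a n a n.+1 + kq_mul cyc (psi_rec (gen a n a) n)).
    by rewrite mid kq_cycle_e0 coefE eqxx ifF ?add0r ?addNr //; apply/eqP; lia.
  rewrite addnS -[LHS]/(- gen a n a (n.+1 + l).+1 +
    kq_mul cyc (psi_rec (gen a n a) (n.+1 + l))).
  by rewrite IH kq_mul0 coefE !ifF ?addr0 ?oppr0 //; apply/eqP; lia.
case: (ltngtP m n) => [mn|nm|->].
- by rewrite low // /e_lim unitv_neq // => -[_ mE]; rewrite mE ltnn in mn.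
- have -> : m = (n.+1 + (m - n.+1))%N by lia.
  by rewrite high /e_lim unitv_neq // => -[_]; lia.
- by rewrite mid /e_lim unitvE.
Qed.

Lemma psi_I x : I x -> mem F (psi x).
Proof.
suff IF y : I y -> mem F y /\ mem F (psi y) by move/IF => [].
apply: (@I_sub_of_gen (fun y => mem F y /\ mem F (psi y))) y; last first.
  by move=> a n la; rewrite psi_gen //; split; [apply: F_mem_gen|apply: F_mem_e_lim].
apply: submod_of_act => //.
- by move=> y [].
- split; first exact: rmod0.
  rewrite -(mact0m HF 0) psiM; apply: F_mem_sub (rmod0 HF) => xi n _ /=.
  by rewrite kq_mul0.
- by move=> y z [my py] [mz pz]; rewrite psiD; split; apply: rmodD.
- by move=> y r [my py]; rewrite psiM; split; apply: rmodM.
Qed.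

Lemma hom_psi : @hom K k (@restrict K k F I) F psi.
Proof.
by split=> /= [x /psi_I|x y _ _|x r _]; [|apply: psiD|apply: psiM].
Qed.

(** The recursion multiplies by the cycle at each step, so the value at vertex 0 in column n is
    -X^((k+1)n), which is never zero. *)
Lemma psi_unit_notin_F a x : limit a -> x a 0%N = e0 ->
  (forall n, x a n.+1 = 0) -> ~ mem F (psi x).
Proof.
move=> la x0 xS [[s sx] _].
have nz n : psi x a n <> 0.
  rewrite psi_limit // => /ffunP/(_ ord0).
  suff -> : psi_rec (x a) n ord0 = - ('X^(k.+1) ^+ n).
    by rewrite ffunE -exprM; apply/eqP; rewrite oppr_eq0 monic_neq0 // monicXn.
  elim: n => [|n IH]; first by rewrite /= x0 !ffunE eqxx expr0.
  by rewrite /= xS oppr0 add0r kq_cycle_mul0 IH mulrN -exprS.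
have [N sN] : exists N, forall xi n, List.In (xi, n) s -> (n < N)%N.
  elim: s {sx} => [|[g m] s [N sN]]; first by exists 0%N.
  exists (maxn m.+1 N) => xi n /= [[_ <-]|/sN nN]; rewrite leq_max ?leqnn //.
  by rewrite nN orbT.
by have := sN a N (sx a N (nz N)); rewrite ltnn.
Qed.

End LadderModule.

(** * Vanishing of Ext *)

Section ExtensionVanishing.
Variables (K : fieldType) (k : nat) (O : Type) (lt : O -> O -> Prop).
Variables (C : O -> nat -> O).
Hypothesis (goodC : good_ladder lt C).
Local Notation KQ := (KQ K k).
Local Notation F := (Fmod K k lt).
Local Notation e0 := (kq_e0 K k).
Local Notation cyc := (kq_cycle K k).
Local Notation I := (I_sub lt C).
Local Notation gen := (Ggen K k lt C).
Local Notation M := (M_omega1 K k lt C).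
Local Notation limit := (is_limit lt).
Local Notation Fb := (@restrict K k F (@Fbase K k O lt)).
Local Notation Im := (@restrict K k F I).
Implicit Types (a xi : O) (n m : nat).

Let HF : is_rmod F := Fmod_is_rmod K k lt.
Let HI : is_rmod Im := restrict_is_rmod HF (I_is_submod K k lt C).
Let HFb : is_rmod Fb := restrict_is_rmod HF (Fbase_is_submod K k lt).
Let I_mem x : I x -> mem F x.
Proof. by case. Qed.

Lemma hom_eq_on_I (N : rmod K k) f g : is_rmod N ->
  @hom K k Im N f -> @hom K k Im N g ->
  (forall a n, limit a -> f (gen a n) = g (gen a n)) ->
  forall x, I x -> f x = g x.
Proof.
move=> HN hf hg fg x.
have [_ HS] := equalizer_is_submod HI HN hf hg.
suff IS y : I y -> I y /\ f y = g y by move/IS => [].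
apply: (@I_sub_of_gen _ _ _ _ _ (fun z => I z /\ f z = g z)) y.
  by split; [move=> y [/I_mem]|exact: HS].
by move=> a n la; split; [apply: I_gen|apply: fg].
Qed.

(** From N on, y = 0 is a solution. Below N the equations are solved downwards, since [y n] occurs
    with coefficient -1 and is determined by [y n.+1]. *)
Lemma ladder_recursion N (z c : nat -> KQ) :
  (forall n, (N <= n)%N -> z n = c n) ->
  exists y : nat -> KQ, forall n, z n - y n + kq_mul (y n.+1) cyc = c n.
Proof.
elim: N z c => [|N IH] z c zc.
  by exists (fun=> 0) => n; rewrite zc // kq_0mul subr0 addr0.
have [n nN|y yP] := IH (z \o succn) (c \o succn); first exact: (zc n.+1).
exists (fun n => if n is n'.+1 then y n' else z 0%N + kq_mul (y 0%N) cyc - c 0%N).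
by case=> [|n]; [rewrite opprB addrCA opprD (addrA (z 0%N)) subrr add0r subrK | exact: yP].
Qed.

Lemma UP_extend : countable_set (fun _ : KQ => True) -> UP lt ->
  forall phi, @hom K k Im (KQmod K k) phi ->
  exists h, @hom K k F (KQmod K k) h /\ forall x, I x -> h x = phi x.
Proof.
move=> cKQ up phi hphi.
have [ladC _] := goodC.
(* The countable sets are all KQ itself, and the colour of the n-th rung is the prescribed value of
   [phi]. *)
have [||f0 f0P] := up KQ (fun _ _ => True) _ C ladC (fun a n => phi (gen a n)) => //.
have /choice [Y YP] a : exists y : nat -> KQ, limit a -> forall n,
    f0 (C a n) - y n + kq_mul (y n.+1) cyc = phi (gen a n).
  have [la|nla] := EM (limit a); last by exists (fun=> 0).
  have [N zN] := f0P a la.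
  by have [y yP] := ladder_recursion zN; exists y.
pose p xi n := if excluded_middle_informative (limit xi) then Y xi n else f0 xi.
have HK := KQmod_is_rmod K k.
have [//|h [hh hE]] := @free_map K k O lt (KQmod K k) p HK.
exists h; split=> //; apply: hom_eq_on_I => // [|a n la].
  by apply: hom_restrict hh => y /I_mem.
have [_ hD ha] := hh; have [_ _ phia] := hphi.
(* The equation solved by [Y] holds in KQ; [h] realises it after right multiplication by e_0, which
   fixes [phi (gen a n)]. *)
have -> : phi (gen a n) = kq_mul (phi (gen a n)) e0.
  by rewrite -[in LHS](gen_e0 K k C n la); apply: (phia _ e0); apply: I_gen.
rewrite hD; last 2 first.
- by apply: rmodD => //; [apply: F_mem_e_succ|apply: rmodN => //; apply: F_mem_e_lim].
- by apply: rmodM => //; apply: F_mem_e_lim.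
rewrite (homB HF HK hh); [|exact: F_mem_e_succ|exact: F_mem_e_lim].
rewrite ha; last exact: F_mem_e_lim.
rewrite !hE; [|exact: F_mem_e_lim..|exact: F_mem_e_succ].
have -> : p (C a n) 0%N = f0 (C a n).
  rewrite /p; case: excluded_middle_informative => // lC.
  by case: (ladder_not_limit goodC la lC).
have pY m : p a m = Y a m by rewrite /p; case: excluded_middle_informative.
rewrite !pY /=.
by rewrite -YP // !kq_mulDl kq_Nmul -!kq_mulA kq_e0_cycle kq_cycle_e0.
Qed.

(** * Comparison with an arbitrary projective resolution *)

Section Resolution.
Variables (P : nat -> rmod K k) (d : forall n, car (P n.+1) -> car (P n)).
Variable (eps : car (P 0) -> car M).
Hypothesis res : proj_resolution d eps.

Let HP n : is_rmod (P n). Proof. by case: res => /(_ n) []. Qed.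
Let pP n : projective (P n). Proof. by case: res => /(_ n) []. Qed.
Let heps : hom eps. Proof. by case: res => _ []. Qed.
Let hd n : hom (@d n). Proof. by case: res => _ [_ []]. Qed.
Let eps_onto D : mem M D -> exists x, mem (P 0) x /\ eps x = D.
Proof. by case: res => _ [_ [_ [+ _]]]; apply. Qed.
Let ker_eps x : mem (P 0) x ->
  (eps x = mzero M <-> exists y, mem (P 1) y /\ d y = x).
Proof. by case: res => _ [_ [_ [_ [+ _]]]]; apply. Qed.
Let ker_d n x : mem (P n.+1) x ->
  (d x = mzero (P n) <-> exists y, mem (P n.+2) y /\ d y = x).
Proof. by case: res => _ [_ [_ [_ [_]]]]; apply. Qed.
Let HM : is_rmod M := M_is_rmod K k lt C.
Let d_mem n y : mem (P n.+1) y -> mem (P n) (d y).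
Proof. by case: (hd n) => + _ _; apply. Qed.

(** By exactness y - z is a boundary, where a cocycle vanishes. *)
Lemma cocycle_eq N (f : car (P N.+1) -> KQ) : @hom K k (P N.+1) (KQmod K k) f ->
  (forall y, mem (P N.+2) y -> f (d y) = 0) ->
  forall y z, mem (P N.+1) y -> mem (P N.+1) z -> d y = d z -> f y = f z.
Proof.
move=> hf f0 y z my mz dyz.
have myz : mem (P N.+1) (madd _ y (mopp _ z)) by apply: rmodD => //; apply: rmodN.
have [|t [mt dt]] := (ker_d myz).1.
  by rewrite (homB (HP _) (HP _) (hd N)) // dyz msubmm //; apply: d_mem.
have := f0 t mt; rewrite dt (homB (HP _) (KQmod_is_rmod K k) hf) //.
by move/subr0_eq.
Qed.

(** [u] and [v] lift the identity of M, [w] continues [u] on I, and [t] is a homotopy from the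
    identity to [u] after [v] in degree zero, existing because x - u (v x) lies in the kernel of
    [eps]. *)
Lemma resolution_comparison :
  exists u v t w,
    [/\ @hom K k F (P 0) u, @hom K k (P 0) Fb v,
        @hom K k (P 0) (P 1) t & @hom K k Im (P 1) w] /\
    [/\ forall x, mem (P 0) x -> d (t x) = madd (P 0) x (mopp (P 0) (u (v x))),
        forall x, I x -> d (w x) = u x &
        forall y, mem (P 1) y -> I (v (d y))].
Proof.
have [em eD ea] := heps.
have /choice [p pE] (j : O * nat) : exists z, mem (P 0) z /\
    (basis lt (unitv j.1 j.2 e0) -> eps z = @cls K k F I (unitv j.1 j.2 e0)).
  have [bj|nbj] := EM (basis lt (unitv j.1 j.2 e0)).
    have [|x [mx ex]] := eps_onto (D := @cls K k F I (unitv j.1 j.2 e0)).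
      by apply/mem_MP; exists (unitv j.1 j.2 e0); split=> //; apply: Fbase_basis.
    by exists x.
  by exists (mzero (P 0)); split=> //; apply: rmod0.
(* [u] is defined on the free module F; its restriction to [Fbase] lifts the projection to M. *)
have [xi n|u [hu uE]] := @free_map K k O lt _ (fun xi n => p (xi, n)) (HP 0).
  by case: (pE (xi, n)).
have [um uD ua] := hu.
have huF : @hom K k Fb (P 0) u by apply: hom_restrict hu => x [].
have eu x : Fbase lt x -> eps (u x) = @cls K k F I x.
  suff: Fbase lt x -> Fbase lt x /\ eps (u x) = @cls K k F I x by move=> + bx => /(_ bx) [].
  have [_ HS] :=
    equalizer_is_submod HFb HM (hom_comp huF heps) (hom_proj K k lt C).
  apply: (@span_sub _ _ F (@basis K k O lt)
    (fun y => Fbase lt y /\ eps (u y) = @cls K k F I y)).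
    by split; [move=> y [[]]|exact: HS].
  move=> y bY; split; first exact: Fbase_basis.
  have [xi [n yE]] : exists xi n, y = unitv xi n e0.
    by case: bY => [[g [_ ->]]|[a [n [_ ->]]]]; [exists g, 0%N|exists a, n].
  rewrite yE in bY *; have [mp ep] := pE (xi, n).
  rewrite uE; last exact: F_mem_basis.
  rewrite ea // ep // /M_omega1 /FmodI [LHS]mact_cls ?basis_e0 //.
  - exact: I_is_submod.
  - exact: F_mem_basis.
have [x mx|v [hv vE]] := projective_lift (HP 0) (@pP 0) HFb HM (hom_proj K k lt C) heps.
  by have /mem_MP [y [bY ->]] := em x mx; exists y.
have [vm vD va] := hv.
have vI x : mem (P 0) x -> eps x = mzero M -> I (v x).
  by move=> mx ex; apply/(proj_eq0 C (vm x mx)); rewrite vE.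
have hq : @hom K k (P 0) (P 0) (fun x => madd (P 0) x (mopp (P 0) (u (v x)))).
  apply: hom_sub => //.
  exact: (hom_comp hv huF).
have [x mx|t [ht tE]] := projective_lift (HP 0) (@pP 0) (HP 1) (HP 0) (hd 0) hq.
  have mv := vm x mx; have [hqm _ _] := hq.
  apply/ker_eps; first exact: hqm.
  rewrite (homB (HP 0) HM heps) // ?eu // ?vE ?msubmm //; first exact: em.
  exact/um/Fbase_mem.
have /choice [w0 w0E] (j : O * nat) : exists z, mem (P 1) z /\
    (limit j.1 -> d z = u (gen j.1 j.2)).
  case: j => a n /=.
  have [la|nla] := EM (limit a); last first.
    by exists (mzero (P 1)); split=> //; apply: rmod0.
  have [|y [my dy]] := (ker_eps (um _ (F_mem_gen K k C n la))).1; last by exists y.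
  by rewrite eu; [apply/proj_eq0; [apply: Fbase_gen|apply: I_gen]|apply: Fbase_gen].
have [xi n|u1 [hu1 u1E]] := @free_map K k O lt _ (fun xi n => w0 (xi, n)) (HP 1).
  by case: (w0E (xi, n)).
have hw := hom_comp (hom_psi K k goodC) hu1.
(* [psi] carries [gen a n] to [e_lim a n], which [u1] sends to the chosen preimage of [u (gen a n)],
   up to a factor e_0. *)
exists u, v, t, (fun x => u1 (psi lt x)); split; split=> //; last first.
  by move=> y my; apply: vI; [apply: d_mem|apply/ker_eps; [apply: d_mem|exists y]].
apply: hom_eq_on_I => //; first exact: (hom_comp hw (hd 0)).
  by apply: hom_restrict hu => x /I_mem.
move=> a n la; have [mw dw] := w0E (a, n).
rewrite psi_gen // u1E; last exact: F_mem_e_lim.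
have [_ _ da] := hd 0.
by rewrite da // dw // -ua ?gen_e0 //; apply: F_mem_gen.
Qed.

Definition boundary n (z : car (P n)) : Prop := exists y, mem (P n.+1) y /\ d y = z.

Lemma boundary_mem n z : @boundary n z -> mem (P n) z.
Proof. by move=> [y [my <-]]; apply: d_mem. Qed.

(** The map x - s (d x) takes values in the cycles, so it lifts along the next differential. On a
    boundary z the correction disappears because d z = 0. *)
Lemma extend_section n s : @hom K k (restrict (@boundary n)) (P n.+1) s ->
  (forall z, boundary z -> d (s z) = z) ->
  exists t, @hom K k (P n.+1) (P n.+2) t /\
    forall z, @boundary n.+1 z -> d (t z) = z.
Proof.
move=> hs sE; have [sm sD sa] := hs.
have hq : @hom K k (P n.+1) (P n.+1) (fun x => madd _ x (mopp _ (s (d x)))).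
  apply: hom_sub => //.
  apply: (hom_comp (N := restrict (@boundary n))) hs.
  have [dm dD da] := hd n.
  by split=> // x mx; exists x.
have [x mx|t [ht tE]] := projective_lift (HP _) (@pP _) (HP n.+2) (HP _) (hd n.+1) hq.
  have ix : boundary (d x) by exists x.
  have ms := sm _ ix.
  apply/ker_d; first by case: hq => + _ _; apply.
  by rewrite (homB (HP _) (HP _) (hd n)) // sE // msubmm //; apply: d_mem.
exists t; split=> //.
move=> z iz; have mz := boundary_mem iz; rewrite tE //.
have -> : d z = mzero (P n) by apply/ker_d.
have i0 : boundary (mzero (P n)).
  exists (mzero (P n.+1)); split; first exact: rmod0.
  exact: (hom0 (HP _) (HP _) (hd n)).
have -> : s (mzero (P n)) = mzero (P n.+1).
  rewrite -(mact0m (HP n) 0) (sa _ 0 i0) mact0 //; exact: sm.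
by rewrite msubm0.
Qed.

(** For z in the image of [d 0], v z lies in I, so z = d (t z) + u (v z) = d (t z + w (v z)). Higher
    degrees follow by [extend_section]. *)
Lemma section_on_boundary n : exists s, @hom K k (restrict (@boundary n)) (P n.+1) s /\
  forall z, boundary z -> d (s z) = z.
Proof.
elim: n => [|n [s [hs sE]]].
  have [u [v [t [w [[hu hv ht hw] [tE wE vI]]]]]] := resolution_comparison.
  have [vm vD va] := hv; have [wm _ _] := hw; have [tm _ _] := ht; have [um _ _] := hu.
  have hv' : @hom K k (restrict (@boundary 0)) Im v.
    split=> [_ [y [my <-]]|x y /boundary_mem mx /boundary_mem my|x r /boundary_mem mx].
    - exact: vI.
    - exact: vD.
    - exact: va.
  exists (fun z => madd (P 1) (t z) (w (v z))); split.
    apply: hom_add => //; last exact: (hom_comp hv' hw).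
    by apply: hom_restrict ht => x /boundary_mem.
  move=> z iz; have mz := boundary_mem iz; have [_ dD _] := hd 0.
  have Iv : I (v z) by case: iz => y [my <-]; apply: vI.
  rewrite dD ?tE ?wE ?msubKm //; [|exact: tm|exact: wm].
  exact/um/I_mem.
have [t [ht tE]] := extend_section hs sE; exists t; split=> //.
by apply: hom_restrict ht => x /boundary_mem.
Qed.

Lemma cocycle0_coboundary : countable_set (fun _ : KQ => True) -> UP lt ->
  forall f, @hom K k (P 1) (KQmod K k) f ->
  (forall y, mem (P 2) y -> f (d y) = 0) ->
  exists g, @hom K k (P 0) (KQmod K k) g /\ forall y, mem (P 1) y -> f y = g (d y).
Proof.
move=> cKQ up f hf f0.
have [u [v [t [w [[hu hv ht hw] [tE wE vI]]]]]] := resolution_comparison.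
have [h [hh hE]] := UP_extend cKQ up (hom_comp hw hf).
have [_ fD _] := hf; have [tm _ _] := ht; have [wm _ _] := hw.
have [_ dD _] := hd 0; have [um _ _] := hu.
(* At d y this is f (t (d y) + w (v (d y))), and that argument has the same differential as y. *)
exists (fun x => madd (KQmod K k) (f (t x)) (h (v x))); split.
  apply: hom_add; [exact: KQmod_is_rmod|exact: (hom_comp ht hf)|].
  by apply: (hom_comp hv); apply: hom_restrict hh => x /Fbase_mem.
move=> y my; have md := d_mem my; have Iv := vI y my.
have mt := tm _ md; have mw := wm _ Iv.
rewrite hE // -fD //; apply: (cocycle_eq hf f0) => //; first exact: rmodD.
by rewrite dD // tE // wE // msubKm //; apply/um/I_mem.
Qed.

Lemma cocycleS_coboundary n f : @hom K k (P n.+2) (KQmod K k) f ->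
  (forall y, mem (P n.+3) y -> f (d y) = 0) ->
  exists g, @hom K k (P n.+1) (KQmod K k) g /\
    forall y, mem (P n.+2) y -> f y = g (d y).
Proof.
move=> hf f0; have [s [hs sE]] := section_on_boundary n.
have [t [ht tE]] := extend_section hs sE; have [tm _ _] := ht.
exists (fun x => f (t x)); split; first exact: (hom_comp ht hf).
move=> y my; apply: (cocycle_eq hf f0) => //; first exact/tm/d_mem.
by rewrite tE //; exists y.
Qed.

End Resolution.

Lemma Ext_vanish_M m : countable_set (fun _ : KQ => True) -> UP lt ->
  Ext_vanish m M (KQmod K k).
Proof.
move=> cKQ up P d eps res f hf f0; case: m f hf f0 => [|m] f hf f0.
  exact: (cocycle0_coboundary res cKQ up hf f0).
exact: (cocycleS_coboundary res hf f0).
Qed.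

End ExtensionVanishing.

(** * Failure of projectivity *)

Section Omega1Closure.
Variables (O : Type) (lt : O -> O -> Prop).
Hypothesis omega1 : is_omega1 lt.

Let lt_trans x y z : lt x y -> lt y z -> lt x z.
Proof. by case: omega1 => _ [+ _]; apply. Qed.
Let lt_total x y : lt x y \/ x = y \/ lt y x.
Proof. by case: omega1 => _ [_ [+ _]]; apply. Qed.
Let lt_wf : well_founded lt. Proof. by case: omega1 => _ [_ [_ []]]. Qed.
Let uncountable : ~ exists f : O -> nat, forall x y, f x = f y -> x = y.
Proof. by case: omega1 => _ [_ [_ [_ []]]]. Qed.
Let countable_below a : exists f : O -> nat,
  forall x y, lt x a -> lt y a -> f x = f y -> x = y.
Proof. by case: omega1 => _ [_ [_ [_ [_ +]]]]; apply. Qed.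

(** Regularity of omega_1. Under an unbounded sequence every b lies at or below some [s n], and n
    together with the position of b in the countable segment below [s n] (or [None] if b = s n)
    would number all of [O]. *)
Lemma omega1_seq_bounded (s : nat -> O) : exists b, forall n, lt (s n) b.
Proof.
apply: contrapT => unb; apply: uncountable.
have [f fP] := choice countable_below.
have /choice [n nP] b : exists n, ~ lt (s n) b.
  by apply: contrapT => nb; apply: unb; exists b => n; apply: contrapT => ?; apply: nb; exists n.
pose code b : nat * option nat :=
  (n b, if excluded_middle_informative (b = s (n b)) then None else Some (f (s (n b)) b)).
exists (fun b => pickle (code b)) => x y /(pcan_inj pickleK) [nE].
have below z : z <> s (n z) -> lt z (s (n z)).
  by move=> zs; have := nP z; case: (lt_total z (s (n z))) => // -[].
case: excluded_middle_informative => ex; case: excluded_middle_informative => ey //.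
  by move=> _; rewrite ex ey nE.
move=> [] /= fE; apply: (fP (s (n x))) => //; first exact: below.
  by rewrite nE; apply: below.
by rewrite fE nE.
Qed.

Lemma omega1_min (A : O -> Prop) : (exists x, A x) ->
  exists x, A x /\ forall y, lt y x -> ~ A y.
Proof.
move=> [x Ax]; apply: contrapT => nomin.
elim/(well_founded_ind lt_wf): x Ax => x IH Ax.
by apply: nomin; exists x; split=> // y yx /IH; apply.
Qed.

(** Closing off: [B] takes b to a bound for b and for all values of [g] below b, and the supremum of
    the iterates of [B] is a limit closed under [g]. *)
Lemma omega1_closed_limit (g : O -> seq O) : exists a, is_limit lt a /\
  forall x, lt x a -> forall y, List.In y (g x) -> lt y a.
Proof.
have [x0 _] : exists x0 : O, True.
  by apply: contrapT => ne; apply: uncountable; exists (fun=> 0%N) => x; case: ne; exists x.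
have /choice [B BP] b : exists b', lt b b' /\
    forall x, lt x b -> forall y, List.In y (g x) -> lt y b'.
  have [f fP] := countable_below b.
  have /choice [s sP] (ij : nat * nat) : exists y, forall x,
      lt x b -> f x = ij.1 -> y = List.nth ij.2 (g x) b.
    have [[x [xb fx]]|no] := EM (exists x, lt x b /\ f x = ij.1).
      exists (List.nth ij.2 (g x) b) => x' x'b fx'.
      by rewrite (fP x x') // fx fx'.
    by exists b => x xb fx; case: no; exists x.
  have [b' b'P] := omega1_seq_bounded (fun n =>
    if n is n'.+1 then if unpickle n' is Some ij then s ij else b else b).
  exists b'; split=> [|x xb y]; first exact: (b'P 0%N).
  move=> /(List.In_nth _ _ b) [j [_ <-]].
  by have := b'P (pickle (f x, j)).+1; rewrite pickleK (sP _ x).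
pose beta n := iter n B x0.
have beta_lt n : lt (beta n) (beta n.+1) by case: (BP (beta n)).
have [a [ab amin]] := omega1_min (omega1_seq_bounded beta).
have below x : lt x a -> exists n, lt x (beta n).
  move=> /amin nub; apply: contrapT => nx; apply: nub => n.
  case: (lt_total (beta n) x) => // -[e|xb]; last by case: nx; exists n.
  by case: nx; exists n.+1; rewrite -e.
exists a; split; last first.
  move=> x /below [n xn] y gy; apply: lt_trans (ab n.+1).
  by have [_ +] := BP (beta n); apply; first exact: xn.
split; first by move/(_ (beta 0%N)); apply.
move=> x [xa nb]; have [n xn] := below x xa.
by apply: (nb (beta n)).
Qed.

End Omega1Closure.

(** * The ladder module does not split off F' *)

Section NonProjective.
Variables (K : fieldType) (k : nat) (O : Type) (lt : O -> O -> Prop).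
Variables (C : O -> nat -> O).
Hypotheses (omega1 : is_omega1 lt) (goodC : good_ladder lt C).
Local Notation F := (Fmod K k lt).
Local Notation I := (I_sub lt C).
Local Notation M := (M_omega1 K k lt C).
Local Notation Fb := (@restrict K k F (@Fbase K k O lt)).
Local Notation cl := (@cls K k F I).

Lemma M_not_projective : ~ projective M.
Proof.
move=> projM.
have HF := Fmod_is_rmod K k lt; have HM := M_is_rmod K k lt C.
have HFb : is_rmod Fb := restrict_is_rmod HF (Fbase_is_submod K k lt).
have hp := hom_proj K k lt C.
have [|s [hs sE]] := projM Fb cl HFb hp.
  by move=> D /mem_MP [x [bx ->]]; exists x.
pose th x := s (cl x).
have hth : @hom K k Fb Fb th := hom_comp hp hs.
have [thm thD thA] := hth.
have bl a n : is_limit lt a -> Fbase lt (e_lim K k a n).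
  by move=> la; apply: Fbase_basis; right; exists a, n.
have bs g : ~ is_limit lt g -> Fbase lt (e_succ K k g).
  by move=> ng; apply: Fbase_basis; left; exists g.
(* Closing off under these finite supports gives a limit [a] such that [th] sends every nonlimit
   basis vector below [a] to an element supported below [a]. *)
have /choice [supp suppP] g : exists l : seq O, ~ is_limit lt g ->
    forall xi m, th (e_succ K k g) xi m <> 0 -> List.In xi l.
  have [lg|/bs/thm [[[l lP] _] _]] := EM (is_limit lt g); first by exists [::].
  exists [seq j.1 | j <- l] => _ xi m /lP.
  by apply: (List.in_map fst).
have [a [la aP]] := omega1_closed_limit omega1 supp.
have [irr _] := omega1; have [ladC _] := goodC; have [_ Cl _] := ladC a la.
have th0 m n : th (e_lim K k a n) a m = 0.
  (* [th] kills [gen a n], and the ladder term has no coordinate at [a]; what remains says that the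
     coordinate for n is the one for n+1 times the cycle. *)
  move: n; apply: (@kq_cycle_divisible_eq0 K k) => n.
  have nlC := ladder_not_limit goodC (n := n) la.
  have thC : th (e_succ K k (C a n)) a m = 0.
    apply: contrapT => nz; apply: (irr a).
    by apply: (aP (C a n)) => //; apply: suppP nz.
  have : th (Ggen K k lt C a n) a m = 0.
    have -> : th (Ggen K k lt C a n) = mzero Fb; last by [].
    rewrite /th (proj_eq0 C (Fbase_gen K k goodC n la)).2; last exact: I_gen.
    exact: (hom0 HM HFb hs).
  have bC := bs _ nlC; have bn := bl a n la; have bn1 := bl a n.+1 la.
  have -> : th (Ggen K k lt C a n) = madd Fb (madd Fb (th (e_succ K k (C a n)))
      (mopp Fb (th (e_lim K k a n)))) (mact Fb (th (e_lim K k a n.+1)) (kq_cycle K k)).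
    rewrite -thA // -(homB HFb HFb hth) // -thD //; last exact: (rmodM HFb).
    by apply: (rmodD HFb) => //; apply: (rmodN HFb).
  by rewrite /= thC add0r addrC => /subr0_eq.
have ba := bl a 0%N la.
(* [th] does not change classes modulo I, so x lies in I; by [th0] its row at [a] is that of
   [e_lim a 0]. *)
pose x := madd F (e_lim K k a 0%N) (mopp F (th (e_lim K k a 0%N))).
have xb : Fbase lt x by apply: (rmodD HFb) => //; apply: (rmodN HFb); apply: thm.
have /(psi_I goodC) : I x.
  apply/(proj_eq0 C xb); have mt := thm _ ba.
  have -> : cl x = madd M (cl (e_lim K k a 0%N)) (mopp M (cl (th (e_lim K k a 0%N)))).
    exact: (homB HFb HM hp).
  rewrite /th sE ?msubmm //; by case: hp => + _ _; apply.
apply: (psi_unit_notin_F (a := a)) => // [|n].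
  by rewrite /x /= th0 subr0 /e_lim unitvE.
by rewrite /x /= th0 subr0 /e_lim unitv_neq // => -[].
Qed.

End NonProjective.

Theorem theorem2p8 (K : countClosedFieldType) (k : nat)
  (O : Type) (lt : O -> O -> Prop) (C : O -> nat -> O) :
  is_omega1 lt -> good_ladder lt C -> UP lt ->
  Ext_vanish 0 (M_omega1 K k lt C) (KQmod K k) /\
  ~ (forall M : rmod K k, is_rmod M ->
       (forall m, Ext_vanish m M (KQmod K k)) -> projective M).
Proof.
move=> omega1 goodC up.
have cKQ : countable_set (fun _ : KQ K k => True).
  (* K is a countable type, so [pickle] numbers the finite functions into polynomials over K. *)
  exists (fun x : {ffun 'I_k.+1 -> {poly K}} => pickle x) => x y _ _.
  exact: (pcan_inj pickleK).
split; first exact: Ext_vanish_M.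
move=> allproj; apply: (M_not_projective omega1 goodC); apply: allproj.
  exact: M_is_rmod.
by move=> m; apply: Ext_vanish_M.
Qed.
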